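(* Let $\Xi\subseteq\Pi$ and assume that the choice of reduced sequences $\{I_w\}_{w\in W}$ is $\Xi$-compatible. If $u\in W^\Xi$ and $w\in W$, then $$A_{\Pi/\Xi}\big(X_{I_u}^\star\, A_\Xi(B_{I_w^{\mathrm{rev}}}(x_\Pi f_e))\big)=\delta_{w,u}\,\mathbf 1,$$ where $\delta_{w,u}$ is the Kronecker symbol. Consequently, the pairing $$(\mathbf D_F^\star)^{W_\Xi}\times(\mathbf D_F^\star)^{W_\Xi}\to(\mathbf D_F^\star)^W\cong S,\qquad(\sigma,\sigma')\mapsto A_{\Pi/\Xi}(\sigma\sigma')$$ is non-degenerate, and $\{A_\Xi(B_{I_u^{\mathrm{rev}}}(x_\Pi f_e))\}_{u\in W^\Xi}$ and $\{X_{I_u}^\star\}_{u\in W^\Xi}$ are dual $S$-bases of $(\mathbf D_F^\star)^{W_\Xi}$.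
   Context: Setting. $R$ is a commutative ring with unit and $F\in R[[x,y]]$ is a one-dimensional commutative formal group law. $(\Lambda,\Sigma)$ is a reduced semisimple root datum: $\Lambda$ is a free abelian group of finite rank, $\Sigma\subset\Lambda$ is the finite set of roots with coroots $\alpha^\vee\in\Lambda^\vee$, and $\Sigma$ spans $\Lambda\otimes\mathbb Q$. $\Pi=\{\alpha_1,\dots,\alpha_n\}$ is a set of simple roots, $\Sigma^{\pm}$ are the positive/negative roots, $W$ is the Weyl group generated by $s_\alpha(\lambda)=\lambda-\alpha^\vee(\lambda)\alpha$, $s_i=s_{\alpha_i}$, $\ell$ is the length function, $e$ the neutral element. The formal group algebra $S=R[[\Lambda]]_F$ is the quotient of $R[[x_\lambda,\lambda\in\Lambda]]$ (completion of the polynomial ring at the augmentation ideal) by the closure of the ideal generated by $x_0$ and all $x_{\lambda+\mu}-F(x_\lambda,x_\mu)$; $W$ acts by $w(x_\lambda)=x_{w(\lambda)}$. Standing assumption: $x_\alpha$ is not a zero divisor in $S$ for all $\alpha\in\Sigma$. $Q=S[x_\alpha^{-1}\mid\alpha\in\Sigma]$. $Q_W$ is the free left $Q$-module with basis $(\delta_w)_{w\in W}$ and product $(q\delta_w)(q'\delta_{w'})=q\,w(q')\,\delta_{ww'}$. Put $X_i=\frac1{x_{\alpha_i}}(1-\delta_{s_i})$. For a sequence $I=(i_1,\dots,i_m)$ put $X_I=X_{i_1}\cdots X_{i_m}$, $X_\emptyset=1$, $I^{\mathrm{rev}}=(i_m,\dots,i_1)$. For each $w\in W$ a reduced sequence $I_w$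 is chosen ($w=s_{i_1}\cdots s_{i_m}$, $m=\ell(w)$, $I_e=\emptyset$). $\mathbf D_F\subseteq Q_W$ is the $R$-subalgebra generated by $S$ and $X_1,\dots,X_n$; $(X_{I_w})_w$ is a basis of $\mathbf D_F$ as a left $S$-module and of $Q_W$ as a left $Q$-module. $Q_W^*=\mathrm{Hom}_Q(Q_W,Q)$ (left $Q$-linear maps), with basis $(f_w)$ dual to $(\delta_w)$, $Q$-bilinear product $f_vf_w=\delta_{v,w}f_v$ and unit $\mathbf 1=\sum_w f_w$. $Q_W$ acts on the left on $Q_W^*$ by $(z\bullet f)(z')=f(z'z)$; $W$ acts by $w(f)=\delta_w\bullet f$, and invariants are with respect to this action. $\mathbf D_F^\star=\mathrm{Hom}_S(\mathbf D_F,S)$ is identified with the subring $\{f\in Q_W^*\mid f(\mathbf D_F)\subseteq S\}$, and $(\mathbf D_F^\star)^W=S\mathbf 1\cong S$. $(X_{I_w}^\star)$ is the $S$-basis of $\mathbf D_F^\star$ dual to $(X_{I_w})$. $B_i(f)=X_i\bullet f$, $B_I=B_{i_1}\circ\cdots\circ B_{i_m}$, $B_\emptyset=\mathrm{id}$. For $\Xi\subseteq\Pi$: $W_\Xi$ is the subgroup of $W$ generated by $s_\alpha$, $\alpha\in\Xi$; $\Sigma_\Xi^-=\{\alpha\in\Sigma^-\mid s_\alpha\in W_\Xi\}$; for $\Xi'\subseteq\Xi$, $x_{\Xi/\Xi'}=\prod_{\alpha\in\Sigma_\Xi^-\setminus\Sigma_{\Xi'}^-}x_\alpha$ and $x_\Xi=x_{\Xi/\emptyset}$.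 For a set $W_{\Xi/\Xi'}$ of representatives of the left cosets $W_\Xi/W_{\Xi'}$, $Y_{\Xi/\Xi'}=\big(\sum_{w\in W_{\Xi/\Xi'}}\delta_w\big)\frac1{x_{\Xi/\Xi'}}$ and $A_{\Xi/\Xi'}(f)=Y_{\Xi/\Xi'}\bullet f$; $A_\Xi=A_{\Xi/\emptyset}$. On $(Q_W^* )^{W_{\Xi'}}$ the operator $A_{\Xi/\Xi'}$ does not depend on the choice of representatives. $W^\Xi=\{w\in W\mid\ell(ws_\alpha)>\ell(w)\ \forall\alpha\in\Xi\}$ is the set of minimal length left coset representatives; each $w\in W$ is uniquely $w=uv$ with $u\in W^\Xi$, $v\in W_\Xi$, and then $\ell(w)=\ell(u)+\ell(v)$. The family $\{I_w\}_{w\in W}$ is $\Xi$-compatible if for all such $w=uv$ the sequence $I_w$ is the concatenation of $I_u$ followed by $I_v$. *)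

(* Defs.v *)
From HB Require Import structures.
From mathcomp Require Import all_boot all_order all_fingroup all_algebra.
From mathcomp Require Import generic_quotient ring_quotient finmap.
From mathcomp Require Import boolp classical_sets.
From mathcomp Require Import monalg.

Set Implicit Arguments.
Unset Strict Implicit.
Unset Printing Implicit Defensive.

Import GRing.Theory.
Local Open Scope ring_scope.
Local Open Scope quotient_scope.

Definition homog (I : choiceType) (R : comNzRingType) (d : nat)
  (p : {malg R[{cmonom I}]}) := forall m, m \in msupp p -> mdeg m = d.

(* R[[x_i, i in I]], the completion of the polynomial ring at its augmentation
   ideal, for an arbitrary set I of variables: an element is a sequence whose
   d-th term is a homogeneous polynomial of degree d. *)
Record pseries (I : choiceType) (R : comNzRingType) := PSeries {
  ps_comp : nat -> {malg R[{cmonom I}]};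
  ps_homog : forall d, homog d (ps_comp d)
}.

Section PSeries.
Variables (I : choiceType) (R : comNzRingType).
Local Notation P := {malg R[{cmonom I}]}.
Local Notation PS := (pseries I R).

HB.instance Definition _ := gen_eqMixin PS.
HB.instance Definition _ := gen_choiceMixin PS.

Lemma pseriesP (f g : PS) : ps_comp f =1 ps_comp g -> f = g.
Proof.
case: f g => [f Hf] [g Hg] /= /funext E; move: Hf; rewrite E => Hf.
by rewrite (Prop_irrelevance Hf Hg).
Qed.

Lemma homogE d (p : P) : homog d p <-> forall m, mdeg m <> d -> p@_m = 0.
Proof.
split=> [h m md|h m]; first by apply: mcoeff_outdom; apply/negP => /h.
rewrite -mcoeff_neq0 => nz; apply: contrapT => /h /eqP; exact/negP.
Qed.

Lemma homog0 d : homog d (0 : P).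
Proof. by move=> m; rewrite msupp0 in_fset0. Qed.

Lemma homogD d (p q : P) : homog d p -> homog d q -> homog d (p + q).
Proof.
move=> /homogE hp /homogE hq; apply/homogE => m md.
by rewrite mcoeffD hp // hq // addr0.
Qed.

Lemma homogN d (p : P) : homog d p -> homog d (- p).
Proof.
by move=> /homogE hp; apply/homogE => m md; rewrite mcoeffN hp // oppr0.
Qed.

Lemma homog_sum d (J : eqType) (r : seq J) (F : J -> P) :
  (forall j, j \in r -> homog d (F j)) -> homog d (\sum_(j <- r) F j).
Proof.
move=> h; rewrite big_seq.
by elim/big_ind: _ => //; [apply: homog0|apply: homogD].
Qed.

Lemma homogU d m c : mdeg m = d -> homog d (<< c *g m >> : P).
Proof.
move=> <-; apply/homogE => m' ne; rewrite mcoeffU; case: eqP => [e|_] //.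
by case: ne; rewrite e.
Qed.

Lemma homogM d e (p q : P) : homog d p -> homog e q -> homog (d + e) (p * q).
Proof.
move=> hp hq; rewrite malgM_def /fgmul.
apply: homog_sum => k1 /hp k1d; apply: homog_sum => k2 /hq k2e.
by apply: homogU; rewrite mdegM k1d k2e.
Qed.

Definition ps_zero : PS := PSeries homog0.

Lemma ps_opp_subproof (f : PS) d : homog d (- ps_comp f d).
Proof. by apply: homogN; apply: ps_homog. Qed.
Definition ps_opp f : PS := PSeries (@ps_opp_subproof f).

Lemma ps_add_subproof (f g : PS) d : homog d (ps_comp f d + ps_comp g d).
Proof. by apply: homogD; apply: ps_homog. Qed.
Definition ps_add f g : PS := PSeries (@ps_add_subproof f g).

Lemma ps_const_subproof (c : R) d :
  homog d (if d == 0%N then c%:MP else 0 : P).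
Proof. by case: eqP => [->|_]; [apply: homogU; rewrite mdeg1|apply: homog0]. Qed.
Definition ps_const c : PS := PSeries (@ps_const_subproof c).

Lemma ps_mul_subproof (f g : PS) d :
  homog d (\sum_(i < d.+1) ps_comp f i * ps_comp g (d - i)).
Proof.
apply: homog_sum => i _.
have := homogM (@ps_homog _ _ f i) (@ps_homog _ _ g (d - i)%N).
by rewrite subnKC // -ltnS.
Qed.
Definition ps_mul f g : PS := PSeries (@ps_mul_subproof f g).

Lemma ps_addA : associative ps_add.
Proof. by move=> f g h; apply: pseriesP => d /=; rewrite addrA. Qed.
Lemma ps_addC : commutative ps_add.
Proof. by move=> f g; apply: pseriesP => d /=; rewrite addrC. Qed.
Lemma ps_add0 : left_id ps_zero ps_add.
Proof. by move=> f; apply: pseriesP => d /=; rewrite add0r. Qed.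
Lemma ps_addN : left_inverse ps_zero ps_opp ps_add.
Proof. by move=> f; apply: pseriesP => d /=; rewrite addNr. Qed.

HB.instance Definition _ :=
  GRing.isZmodule.Build PS ps_addA ps_addC ps_add0 ps_addN.

(* the truncation of f as a univariate polynomial in the degree *)
Definition ps_poly N (f : PS) : {poly P} := \poly_(i < N) ps_comp f i.

Lemma ps_mulE (f g : PS) N d : (d < N)%N ->
  ps_comp (ps_mul f g) d = (ps_poly N f * ps_poly N g)`_d.
Proof.
move=> dN; rewrite coefM /=; apply: eq_bigr => i _.
rewrite !coef_poly (leq_ltn_trans (leq_subr _ _) dN).
by rewrite (leq_trans (ltn_ord i) dN).
Qed.

Lemma coefM_eq (p p' q q' : {poly P}) d :
    (forall i, (i <= d)%N -> p`_i = p'`_i) ->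
    (forall i, (i <= d)%N -> q`_i = q'`_i) -> (p * q)`_d = (p' * q')`_d.
Proof.
move=> hp hq; rewrite !coefM; apply: eq_bigr => i _.
by rewrite hp ?hq ?leq_subr // -ltnS.
Qed.

Lemma ps_poly_mul N (f g : PS) i : (i < N)%N ->
  (ps_poly N (ps_mul f g))`_i = (ps_poly N f * ps_poly N g)`_i.
Proof. by move=> iN; rewrite coef_poly iN (ps_mulE _ _ iN). Qed.

Lemma ps_mulC : commutative ps_mul.
Proof.
by move=> f g; apply: pseriesP => d; rewrite !(@ps_mulE _ _ d.+1) // mulrC.
Qed.

Lemma ps_mulA : associative ps_mul.
Proof.
move=> f g h; apply: pseriesP => d; rewrite !(@ps_mulE _ _ d.+1) //.
transitivity ((ps_poly d.+1 f * (ps_poly d.+1 g * ps_poly d.+1 h))`_d).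
  by apply: coefM_eq => // i id; rewrite ps_poly_mul.
by rewrite mulrA; apply: coefM_eq => // i id; rewrite ps_poly_mul.
Qed.

Lemma ps_mul1 : left_id (ps_const 1) ps_mul.
Proof.
move=> f; apply: pseriesP => d /=.
by rewrite big_ord_recl /= mul1r subn0 big1 ?addr0 // => i _; rewrite mul0r.
Qed.

Lemma ps_mulDl : left_distributive ps_mul ps_add.
Proof.
move=> f g h; apply: pseriesP => d /=; rewrite -big_split /=.
by apply: eq_bigr => i _; rewrite mulrDl.
Qed.

Lemma ps_1_neq0 : ps_const 1 != 0.
Proof.
by apply/eqP => /(congr1 (fun f => ps_comp f 0)) /= /eqP; rewrite oner_eq0.
Qed.

HB.instance Definition _ := GRing.Zmodule_isComNzRing.Build PS
  ps_mulA ps_mulC ps_mul1 ps_mulDl ps_1_neq0.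

Lemma ps_var_subproof (i : I) d :
  homog d (if d == 1%N then << (ucm i) >> else 0 : P).
Proof. by case: eqP => [->|_]; [apply: homogU; rewrite mdegU|apply: homog0]. Qed.
Definition ps_var i : PS := PSeries (@ps_var_subproof i).

(* c(f, g) = \sum_(i, j) c i j f^i g^j for f and g with zero constant term:
   the terms with i > d or j > d do not contribute to degree d. *)
Lemma ps_subst_subproof (c : nat -> nat -> R) (f g : PS) d :
  homog d (ps_comp (\sum_(i < d.+1) \sum_(j < d.+1)
                      ps_const (c i j) * f ^+ i * g ^+ j) d).
Proof. exact: ps_homog. Qed.
Definition ps_subst c f g : PS := PSeries (@ps_subst_subproof c f g).

Lemma ps_comp0_mul (f g : PS) :
  ps_comp (f * g) 0 = ps_comp f 0 * ps_comp g 0.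
Proof. by rewrite /= big_ord_recl big_ord0 addr0. Qed.

End PSeries.

Section Rename.
Variables (I J : choiceType) (R : comNzRingType) (w : I -> J).

Definition mon_rename (m : {cmonom I}) : {cmonom J} :=
  \big[mmul/mone]_(i <- finsupp m) iterop (m i) mmul (ucm (w i)) mone.

Definition pol_rename (p : {malg R[{cmonom I}]}) : {malg R[{cmonom J}]} :=
  \sum_(m <- msupp p) << p@_m *g mon_rename m >>.

Lemma mdeg_rename m : mdeg (mon_rename m) = mdeg m.
Proof.
rewrite mdeg_prod mdegE; apply: eq_bigr => i _.
elim: (m i) => [|k IH]; first exact: mdeg1.
have S k' : iterop k'.+1 mmul (ucm (w i)) mone =
            mmul (ucm (w i)) (iterop k' mmul (ucm (w i)) mone).
  by case: k' => [|k'] //=; rewrite mulm1.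
by rewrite S mdegM mdegU IH.
Qed.

Lemma ps_rename_subproof (f : pseries I R) d : homog d (pol_rename (ps_comp f d)).
Proof.
apply: homog_sum => m /ps_homog md; apply: homogU.
by rewrite mdeg_rename.
Qed.

(* the substitution x_i |-> x_(w i) *)
Definition ps_rename f : pseries J R := PSeries (@ps_rename_subproof f).

End Rename.

(* a one-dimensional commutative formal group law
   F(x, y) = \sum_(i, j) F i j x^i y^j *)
Record fgl (R : comNzRingType) := FGL {
  fgl_coef :> nat -> nat -> R;
  fgl_unit : forall i, fgl_coef i 0 = (i == 1%N)%:R;
  fgl_comm : forall i j, fgl_coef i j = fgl_coef j i;
  fgl_assoc :
    let x := ps_var R (inord 0 : 'I_3) in
    let y := ps_var R (inord 1 : 'I_3) in
    let z := ps_var R (inord 2 : 'I_3) in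
    ps_subst fgl_coef (ps_subst fgl_coef x y) z =
    ps_subst fgl_coef x (ps_subst fgl_coef y z)
}.

Inductive ideal_span (A : comNzRingType) (G : A -> Prop) : A -> Prop :=
| ideal_span0 : ideal_span G 0
| ideal_spanD a g h : G g -> ideal_span G h -> ideal_span G (a * g + h).

Section FormalGroupAlgebra.
Variables (R : comNzRingType) (F : fgl R) (L : zmodType).
Local Notation PS := (pseries L R).

Inductive fga_rel : PS -> Prop :=
| fga_rel0 : fga_rel (ps_var R 0)
| fga_relD l m :
    fga_rel (ps_var R (l + m) - ps_subst F (ps_var R l) (ps_var R m)).

(* the closure for the topology in which the series without terms of degree
   < k, k : nat, form a basis of neighbourhoods of 0 *)
Definition ps_closure (J : PS -> Prop) (f : PS) :=
  forall k, exists2 g, J g & forall d, (d < k)%N -> ps_comp f d = ps_comp g d.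

Definition fga_ideal : {pred PS} :=
  fun f => `[< ps_closure (ideal_span fga_rel) f >].

Lemma fga_idealr_closed : idealr_closed fga_ideal.
Proof.
split.
- by apply/asboolP => k; exists 0 => //; apply: ideal_span0.
- apply/negP => /asboolP /(_ 1%N)[g Jg] /(_ 0%N isT) E.
  suff g0 : ps_comp g 0 = 0 by move: E => /eqP; rewrite g0 oner_eq0.
  elim: Jg => {g E} [//|a g h Gg _ h0].
  have -> : ps_comp (a * g + h) 0 = ps_comp (a * g) 0 + ps_comp h 0 by [].
  rewrite ps_comp0_mul h0 addr0.
  suff -> : ps_comp g 0 = 0 by rewrite mulr0.
  case: Gg => [//|l m] /=.
  rewrite !big_ord_recl !big_ord0 !addr0 /= fgl_unit /=.
  rewrite big1 ?subr0 // => i _; rewrite big1 ?mul0r // => j _.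
  by rewrite raddf0 if_same mul0r.
move=> a u v /asboolP hu /asboolP hv; apply/asboolP => k.
have [g Jg ug] := hu k; have [h Jh vh] := hv k.
have JM b x : ideal_span fga_rel x -> ideal_span fga_rel (b * x).
  elim=> [|c y z Gy _ IH]; first by rewrite mulr0; apply: ideal_span0.
  by rewrite mulrDr mulrA; apply: ideal_spanD.
have JD x y : ideal_span fga_rel x -> ideal_span fga_rel y ->
    ideal_span fga_rel (x + y).
  by elim=> [|c x' z Gx _ IH] Jy; rewrite ?add0r // -addrA;
    apply: ideal_spanD => //; apply: IH.
exists (a * g + h); first by apply: JD => //; apply: JM.
move=> d dk.
have compD (x y : PS) : ps_comp (x + y) d = ps_comp x d + ps_comp y d by [].
have compM (x y : PS) :
  ps_comp (x * y) d = \sum_(i < d.+1) ps_comp x i * ps_comp y (d - i) by [].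
rewrite (compD _ v) (compD _ h) (compM a u) (compM a g) (vh d dk).
apply: (f_equal (fun x => x + ps_comp h d)).
apply: eq_bigr => i _; rewrite ug //.
exact: leq_ltn_trans (leq_subr _ _) dk.
Qed.

HB.instance Definition _ := isIdealr.Build PS fga_ideal fga_idealr_closed.

(* R[[L]]_F *)
Definition fga := {ideal_quot fga_ideal}.
HB.instance Definition _ := GRing.ComNzRing.on fga.

Definition fga_proj (f : PS) : fga := \pi_({ideal_quot fga_ideal}) f.
Definition fga_var (l : L) : fga := fga_proj (ps_var R l).

End FormalGroupAlgebra.

Definition free_finite_rank (L : zmodType) := exists (r : nat) (b : 'I_r -> L),
  bijective (fun c : {ffun 'I_r -> int} => \sum_i b i *~ c i).

Record root_datum := RootDatum {
  lat : zmodType;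
  lat_free : free_finite_rank lat;
  rootset : {fset lat};
  coroot : rootset -> {additive lat -> int};
  coroot_inj : forall a b, coroot a =1 coroot b -> a = b;
  coroot_root : forall a, coroot a (val a) = 2;
  refl_root : forall a b : rootset,
    val b - val a *~ coroot a (val b) \in rootset;
  refl_coroot : forall a b : rootset, exists c : rootset, forall l,
    coroot c l = coroot b l - coroot b (val a) * coroot a l;
  (* reduced *)
  root2 : forall a : rootset, val a *+ 2 \notin rootset;
  (* semisimple: the roots span the tensor product of lat with the rationals *)
  roots_span : forall l, exists2 k : int, k != 0 &
    exists c : {ffun rootset -> int}, l *~ k = \sum_a val a *~ c a
}.

Definition refl (D : root_datum) (a : rootset D) (l : lat D) : lat D :=
  l - val a *~ coroot a l.

Inductive in_weyl (D : root_datum) : (lat D -> lat D) -> Prop :=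
| in_weyl1 : in_weyl id
| in_weylM a w : in_weyl w -> in_weyl (refl a \o w).

Record weyl (D : root_datum) :=
  Weyl { wact :> lat D -> lat D; wactP : in_weyl wact }.

Section WeylGroup.
Variable D : root_datum.
Implicit Types (w : lat D -> lat D) (a : rootset D).

Lemma weyl_eq (u v : weyl D) : wact u =1 wact v -> u = v.
Proof.
case: u v => [u Pu] [v Pv] /= /funext E; move: Pu; rewrite E => Pu.
by rewrite (Prop_irrelevance Pu Pv).
Qed.

Lemma reflD a : {morph refl a : l m / l + m}.
Proof. by move=> l m; rewrite /refl raddfD mulrzDr opprD addrACA. Qed.

Lemma in_weylD w : in_weyl w -> {morph w : l m / l + m}.
Proof. by elim=> // a v _ IH l m /=; rewrite IH reflD. Qed.

Lemma in_weyl_root w a : in_weyl w -> w (val a) \in rootset D.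
Proof.
by elim=> [|b v _ IH] /=; [apply: valP|apply: (refl_root b [` IH]%fset)].
Qed.

Lemma lat_torsion_free (l : lat D) (k : int) : k != 0 -> l *~ k = 0 -> l = 0.
Proof.
move=> k0; have [r [b [f fK Kf]]] := lat_free D.
rewrite -(Kf l); set c := f l => h.
suff -> : c = 0 by rewrite big1 // => i _; rewrite ffunE mulr0z.
have /(can_inj fK) E : \sum_i b i *~ [ffun i => c i * k] i =
                       \sum_i b i *~ ([ffun=> 0] : {ffun 'I_r -> int}) i.
  rewrite [RHS]big1 => [|i _]; last by rewrite ffunE mulr0z.
  by rewrite -[RHS]h /= mulrz_suml; apply: eq_bigr => i _; rewrite ffunE mulrzA.
apply/ffunP => i; have /ffunP/(_ i) := E; rewrite !ffunE => /eqP.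
by rewrite mulf_eq0 (negbTE k0) orbF => /eqP.
Qed.

Definition weyl_ffun (u : weyl D) : {ffun rootset D -> rootset D} :=
  [ffun a => [` in_weyl_root a (wactP u)]%fset].

Lemma weyl_ffun_inj : injective weyl_ffun.
Proof.
move=> u v E; apply: weyl_eq => l; apply/eqP; rewrite -subr_eq0; apply/eqP.
have ext (w : weyl D) : exists2 W : {additive lat D -> lat D}, W =1 w & True.
  have wB : zmod_morphism (wact w).
    have wD := in_weylD (wactP w); move=> x y.
    by apply/eqP; rewrite eq_sym subr_eq -wD subrK.
  pose m := GRing.isZmodMorphism.Build _ _ (wact w) wB.
  pose W : {additive lat D -> lat D} := HB.pack (wact w) m.
  by exists W.
have [U Uu _] := ext u; have [V Vv _] := ext v; rewrite -Uu -Vv.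
have [k k0 [c cE]] := roots_span l; apply: (lat_torsion_free k0).
rewrite mulrzBl -(raddfMz U) -(raddfMz V) cE (raddf_sum U) (raddf_sum V).
rewrite -sumrB big1 // => a _.
rewrite (raddfMz U) (raddfMz V) Uu Vv; have /ffunP/(_ a) := E; rewrite !ffunE.
by move=> /(congr1 val) /= ->; rewrite subrr.
Qed.

Definition weyl_of_ffun f : option (weyl D) :=
  if pselect (exists u, weyl_ffun u = f) is left h then Some (projT1 (cid h))
  else None.

Lemma weyl_ffunK : pcancel weyl_ffun weyl_of_ffun.
Proof.
move=> u; rewrite /weyl_of_ffun; case: pselect => [h|[]]; last by exists u.
by congr Some; apply: weyl_ffun_inj; apply: projT2 (cid h).
Qed.

HB.instance Definition _ := Finite.copy (weyl D) (pcan_type weyl_ffunK).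

Lemma in_weyl_mul u v : in_weyl u -> in_weyl v -> in_weyl (D := D) (u \o v).
Proof. by elim=> // a w _ IH Pv; apply: in_weylM (IH Pv). Qed.

Lemma in_weyl_refl a : in_weyl (refl a).
Proof. exact: in_weylM (in_weyl1 D). Qed.

Lemma reflK a : involutive (refl a).
Proof.
move=> l; rewrite {1}/refl.
suff -> : coroot a (refl a l) = - coroot a l by rewrite mulrNz opprK subrK.
rewrite raddfB raddfMz coroot_root mulrzz; set c := coroot a l.
by rewrite mulr_natl mulr2n opprD addNKr.
Qed.

Lemma in_weyl_inv w : in_weyl w -> exists2 v, in_weyl v & v \o w =1 id.
Proof.
elim=> [|a u _ [v Pv vu]]; first by exists id => //; apply: in_weyl1.
exists (v \o refl a); first by apply: in_weyl_mul => //; apply: in_weyl_refl.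
by move=> l /=; rewrite reflK; apply: vu.
Qed.

Definition weyl_one : weyl D := Weyl (in_weyl1 D).
Definition weyl_mul (u v : weyl D) : weyl D :=
  Weyl (in_weyl_mul (wactP u) (wactP v)).
Definition weyl_inv (u : weyl D) : weyl D :=
  Weyl (s2valP (cid2 (in_weyl_inv (wactP u)))).

Lemma weyl_mulA : associative weyl_mul.
Proof. by move=> u v w; apply: weyl_eq. Qed.
Lemma weyl_mul1 : left_id weyl_one weyl_mul.
Proof. by move=> u; apply: weyl_eq. Qed.
Lemma weyl_mulV : left_inverse weyl_one weyl_inv weyl_mul.
Proof.
by move=> u; apply: weyl_eq; apply: s2valP' (cid2 (in_weyl_inv (wactP u))).
Qed.

HB.instance Definition _ :=
  Finite_isGroup.Build (weyl D) weyl_mulA weyl_mul1 weyl_mulV.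

Definition srefl (a : rootset D) : weyl D := Weyl (in_weyl_refl a).

End WeylGroup.

(* Sets of simple roots are represented by sets of indices. *)
Record simple_system (D : root_datum) := SimpleSystem {
  srank : nat;
  simple_root :> 'I_srank -> rootset D;
  simple_free : forall c : 'I_srank -> int,
    \sum_i val (simple_root i) *~ c i = 0 -> forall i, c i = 0;
  simple_sign : forall a : rootset D, exists c : 'I_srank -> nat,
    val a = \sum_i val (simple_root i) *+ c i \/
    val a = - \sum_i val (simple_root i) *+ c i
}.

Section Weyl.
Variables (D : root_datum) (P : simple_system D).
Local Notation W := (weyl D).
Local Notation idx := 'I_(srank P).

Definition neg_root (a : rootset D) := exists c : idx -> nat,
  val a = - \sum_i val (P i) *+ c i.

Definition sword (I : seq idx) : W := (\prod_(i <- I) srefl (P i))%g.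

Definition len (w : W) : nat := xget 0%N [set l : nat |
  (exists2 I, sword I = w & size I = l) /\
  (forall I, sword I = w -> (l <= size I)%N)]%classic.

Definition reduced_seq (w : W) (I : seq idx) := sword I = w /\ size I = len w.

Definition parabolic (Xi : {set idx}) : {set W} :=
  <<[set srefl (P i) | i in Xi]>>%g.

(* Sigma_Xi^- *)
Definition neg_parabolic (Xi : {set idx}) (a : rootset D) : bool :=
  `[< neg_root a >] && (srefl a \in parabolic Xi).

(* W^Xi *)
Definition min_reps (Xi : {set idx}) : {set W} :=
  [set w : W | [forall i in Xi, (len w < len (w * srefl (P i))%g)%N]].

Definition coset_reps (Xi Xi' : {set idx}) (X : {set W}) : bool :=
  is_transversal X (lcosets (parabolic Xi') (parabolic Xi)) (parabolic Xi).

Definition compatible (Xi : {set idx}) (I : W -> seq idx) := forall u v,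
  u \in min_reps Xi -> v \in parabolic Xi -> I (u * v)%g = I u ++ I v.

End Weyl.

(* Q = S[x_a^-1 | a root] for S = R[[lat]]_F, with the action of the Weyl group
   on Q induced by w(x_l) = x_(w l). *)
Record localized_fga (R : comNzRingType) (F : fgl R) (D : root_datum) :=
LocalizedFga {
  loc :> comUnitRingType;
  loc_in : {rmorphism fga F (lat D) -> loc};
  loc_unit : forall a : rootset D,
    loc_in (fga_var F (val a)) \is a GRing.unit;
  loc_frac : forall q : loc, exists s (r : seq (rootset D)),
    q * \prod_(a <- r) loc_in (fga_var F (val a)) = loc_in s;
  loc_eq0 : forall s, loc_in s = 0 ->
    exists r : seq (rootset D), s * \prod_(a <- r) fga_var F (val a) = 0;
  loc_act : weyl D -> {rmorphism loc -> loc};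
  loc_actE : forall w f,
    loc_act w (loc_in (fga_proj F f)) = loc_in (fga_proj F (ps_rename w f))
}.

Section TwistedGroupAlgebra.
Variables (R : comNzRingType) (F : fgl R) (D : root_datum).
Variables (P : simple_system D) (Q : localized_fga F D).
Local Notation W := (weyl D).
Local Notation S := (fga F (lat D)).
Local Notation idx := 'I_(srank P).

(* Q_W and its dual Hom_Q(Q_W, Q) *)
Definition QW := {ffun W -> (loc Q)^o}.
Definition QWdual := 'Hom(QW, (loc Q)^o).

Definition delta (w : W) : QW := [ffun v => (v == w)%:R].

Definition qw_mul (z z' : QW) : QW :=
  \sum_w \sum_w' (z w * loc_act Q w (z' w')) *: delta (w * w')%g.

Definition xroot (a : rootset D) : Q := loc_in Q (fga_var F (val a)).

Definition X_ (i : idx) : QW :=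
  (xroot (P i))^-1 *: (delta 1%g - delta (srefl (P i))).

Definition X_seq (I : seq idx) : QW :=
  foldr (fun i z => qw_mul (X_ i) z) (delta 1%g) I.

(* D_F; closure under R-scalars follows from the constructors for S and * *)
Inductive in_DF : QW -> Prop :=
| in_DF_S s : in_DF (loc_in Q s *: delta 1%g)
| in_DF_X i : in_DF (X_ i)
| in_DF_add z z' : in_DF z -> in_DF z' -> in_DF (z + z')
| in_DF_mul z z' : in_DF z -> in_DF z' -> in_DF (qw_mul z z').

Definition fdelta (w : W) : QWdual := linfun (fun z : QW => z w).

(* the Q-bilinear product with f_v f_w = delta_(v, w) f_v *)
Definition dual_mul (f g : QWdual) : QWdual :=
  \sum_w (f (delta w) * g (delta w)) *: fdelta w.

Definition dual_one : QWdual := \sum_w fdelta w.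

(* z \bullet f *)
Definition dual_act (z : QW) (f : QWdual) : QWdual :=
  linfun (fun z' : QW => f (qw_mul z' z)).

Definition dual_inv (A : {set W}) (f : QWdual) :=
  forall w, w \in A -> dual_act (delta w) f = f.

(* D_F^* as a subset of Q_W^* *)
Definition in_DFdual (f : QWdual) :=
  forall z, in_DF z -> exists s : S, f z = loc_in Q s.

(* the invariants of D_F^* under W_Xi *)
Definition in_DFdual_inv (Xi : {set idx}) (f : QWdual) :=
  in_DFdual f /\ dual_inv (parabolic Xi) f.

Definition xprod (Xi Xi' : {set idx}) : Q :=
  \prod_(a : rootset D | neg_parabolic Xi a && ~~ neg_parabolic Xi' a) xroot a.

(* Y_(Xi/Xi') and A_(Xi/Xi') for a set X of representatives of W_Xi/W_Xi' *)
Definition Y_ (Xi Xi' : {set idx}) (X : {set W}) : QW :=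
  qw_mul (\sum_(w in X) delta w) ((xprod Xi Xi')^-1 *: delta 1%g).
Definition A_ (Xi Xi' : {set idx}) (X : {set W}) (f : QWdual) : QWdual :=
  dual_act (Y_ Xi Xi' X) f.

(* A_Xi: the only set of representatives of W_Xi/1 is W_Xi *)
Definition A0_ (Xi : {set idx}) : QWdual -> QWdual :=
  A_ Xi finset.set0 (parabolic Xi).

Definition B_seq (I : seq idx) (f : QWdual) : QWdual :=
  foldr (fun i => dual_act (X_ i)) f I.

(* x_Pi f_e *)
Definition xPi_fe : QWdual := xprod [set: idx]%SET finset.set0 *: fdelta 1%g.

(* (X_(I_w)^* )_w: the elements of D_F^* dual to (X_(I_w))_w *)
Definition dual_family (I : W -> seq idx) (Xs : W -> QWdual) :=
  (forall v, in_DFdual (Xs v)) /\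
  (forall v w, Xs v (X_seq (I w)) = (v == w)%:R).

(* (b w), w in A, is a basis of the S-submodule M of Q_W^* *)
Definition S_basis (M : QWdual -> Prop) (A : {set W}) (b : W -> QWdual) :=
  [/\ forall w, w \in A -> M (b w),
      forall f, M f -> exists c : W -> S,
        f = \sum_(w in A) loc_in Q (c w) *: b w &
      forall c : W -> S, \sum_(w in A) loc_in Q (c w) *: b w = 0 ->
        forall w, w \in A -> c w = 0].

Definition nondegenerate_pairing (M : QWdual -> Prop)
    (pair : QWdual -> QWdual -> QWdual) :=
  (forall f, M f -> (forall g, M g -> pair f g = 0) -> f = 0) /\
  (forall g, M g -> (forall f, M f -> pair f g = 0) -> g = 0).

End TwistedGroupAlgebra.

(* Main.v *)
(* Write f(v) for f(delta_v), and call an element of Q integral if it lies in S.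
   The coefficient of delta_w in X_(I_w) is a unit of Q and the other terms of
   X_(I_w) have smaller length, so evaluation at the X_(I_w) is triangular.

   The form <f, g> = sum_w w(1/x_Pi) f(w) g(w) satisfies A_Pi(f g) = <f, g> 1,
   the B_i are self-adjoint for it, and hence
   <f, B_(I^rev)(x_Pi f_e)> = f(X_I).  If f is W_Xi-invariant, the projection
   formula gives A_(Pi/Xi)(f A_Xi(g)) = <f, g> 1.  Since X_(I_u)^* is
   W_Xi-invariant for u in W^Xi, this proves the displayed formula.

   It remains to see that the eta_u = A_Xi(B_(I_u^rev)(x_Pi f_e)), u in W^Xi,
   lie in D_F^* and span the invariants.  Let w_0 and v_0 be the longest
   elements of W and W_Xi.  If f is an invariant in D_F^* that vanishes on the
   elements of W^Xi longer than u, then evaluating the left translate of f by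
   w_0 at X_(I_t), t = w_0 u v_0, shows that f(u) is an integral multiple of
   eta_u(u), which is u(x_(Pi/Xi)) times the leading coefficient of X_(I_u).
   Subtracting multiples of the eta_u proves spanning, as soon as the eta_u lie
   in D_F^*.  For Xi empty they do, because x_Pi f_e is, up to sign, a translate
   of the dual basis element of w_0; therefore < , > is integral on D_F^*.  In
   general, A_Xi(f)(e) = <f, x_(Pi/Xi) 1_(W_Xi)>, and x_(Pi/Xi) 1_(W_Xi) is
   again, up to sign, a translate of a dual basis element; so Y_Xi lies in D_F
   and A_Xi preserves D_F^*. *)

From HB Require Import structures.
Require Import Defs.
From mathcomp Require Import all_boot all_order all_fingroup all_algebra.
From mathcomp Require Import finmap boolp zify ring.
From mathcomp Require classical_sets.
From mathcomp Require Import generic_quotient ring_quotient monalg.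

Set Implicit Arguments.
Unset Strict Implicit.
Unset Printing Implicit Defensive.

Import Order.TTheory GRing.Theory Num.Theory.
Local Open Scope ring_scope.

(** * Root systems and lengths *)

Section Reflections.
Variable D : root_datum.
Local Notation W := (weyl D).
Implicit Types (u v w : W) (a b : rootset D).

Lemma wact_is_zmod_morphism w : zmod_morphism (wact w).
Proof.
have wD := in_weylD (wactP w).
by move=> x y; apply/eqP; rewrite eq_sym subr_eq -wD subrK.
Qed.

HB.instance Definition _ w :=
  GRing.isZmodMorphism.Build _ _ (wact w) (wact_is_zmod_morphism w).

Lemma wactB w : {morph wact w : l m / l - m}. Proof. exact: raddfB. Qed.

Lemma wactN w : {morph wact w : l / - l}. Proof. exact: raddfN. Qed.

Lemma wactMz w k : {morph wact w : l / l *~ k}.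
Proof. by move=> l; apply: raddfMz. Qed.

Lemma wact_sum w (J : finType) (E : J -> lat D) :
  w (\sum_j E j) = \sum_j w (E j).
Proof. exact: raddf_sum. Qed.

Definition ract w a : rootset D := weyl_ffun w a.

Lemma val_ract w a : val (ract w a) = w (val a).
Proof. by rewrite /ract ffunE. Qed.

Lemma ractM u v a : ract (u * v)%g a = ract u (ract v a).
Proof. by apply: val_inj; rewrite !val_ract. Qed.

Lemma ract1 a : ract 1%g a = a.
Proof. by apply: val_inj; rewrite val_ract. Qed.

Lemma ractK w : cancel (ract w) (ract w^-1%g).
Proof. by move=> a; rewrite -ractM mulVg ract1. Qed.

Lemma ractKV w : cancel (ract w^-1%g) (ract w).
Proof. by move=> a; rewrite -ractM mulgV ract1. Qed.

Lemma ract_inj w : injective (ract w). Proof. exact: can_inj (ractK w). Qed.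

Lemma wactK w : cancel (wact w) (wact w^-1%g).
Proof. by move=> l; rewrite -[LHS]/((w^-1 * w)%g l) mulVg. Qed.

Lemma wactKV w : cancel (wact w^-1%g) (wact w).
Proof. by move=> l; rewrite -[LHS]/((w * w^-1)%g l) mulgV. Qed.

Lemma srefl2 a : (srefl a * srefl a = 1)%g.
Proof. by apply: weyl_eq => l; rewrite /= reflK. Qed.

Lemma sreflV a : ((srefl a)^-1 = srefl a)%g.
Proof. by apply/eqP; rewrite eq_invg_mul srefl2. Qed.

Lemma srefl_root a : srefl a (val a) = - val a.
Proof. by rewrite /= /refl coroot_root -[2]/(2%:Z) -pmulrn mulr2n opprD addNKr.
  Qed.

Lemma root_neq0 a : val a != 0.
Proof.
by apply/eqP => a0; have := coroot_root a; rewrite a0 raddf0.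
Qed.

(* The composite of two reflections in [a] is a transvection, and it permutes
   the finite set of roots, hence is trivial. *)
Lemma coroot_uniq a (f : {additive lat D -> int}) : f (val a) = 2 ->
  (forall b, val b - val a *~ f (val b) \in rootset D) -> f =1 coroot a.
Proof.
move=> fa fstab.
have tors l k : l *~ k = 0 -> k != 0 -> l = 0 :> lat D.
  by move=> e k0; apply: lat_torsion_free e.
pose g l := f l - coroot a l.
have gB : zmod_morphism g.
  by move=> x y; rewrite /g (raddfB f) (raddfB (coroot a)); ring.
pose G : {additive lat D -> int} :=
  HB.pack g (GRing.isZmodMorphism.Build _ _ g gB).
have ga : G (val a) = 0 by rewrite /= /g fa coroot_root subrr.
have stab n b : val b + val a *~ (G (val b) *+ n) \in rootset D.
  elim: n b => [|n IH] b; first by rewrite mulr0n mulr0z addr0 (valP b).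
  pose c := [` IH b]%fset.
  have Gc : G (val c) = G (val b).
    by rewrite [LHS](raddfD G) (raddfMz G) ga mul0rz addr0.
  have h : val c - val a *~ f (val c) -
      val a *~ coroot a (val c - val a *~ f (val c)) \in rootset D.
    exact: refl_root a [` fstab c]%fset.
  move: h; rewrite (raddfB (coroot a)) (raddfMz (coroot a)) coroot_root mulrzz.
  have : f (val c) - coroot a (val c) = G (val b) by rewrite -Gc.
  have : val c = val b + val a *~ (G (val b) *+ n) by [].
  move: (val c) (G _) => vc Gb vcE GbE.
  rewrite -[_ - _ *~ f vc - _]addrA -opprD -mulrzDr.
  have -> : f vc + (coroot a vc - 2 * f vc) = - Gb by rewrite -GbE; ring.
  by rewrite mulrNz opprK vcE -addrA -mulrzDr -mulrSr.
have g0 b : G (val b) = 0.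
  apply: contrapT => /eqP nz.
  pose h (n : 'I_(#|{: rootset D}|).+1) := [` stab n b]%fset.
  have /leq_card : injective h.
    move=> m n /(congr1 val) /= /addrI /eqP.
    rewrite -subr_eq0 -mulrzBr => /eqP e; apply/val_inj/eqP; move: e.
    rewrite -[G _ *+ _]mulr_natr -[X in _ - X]mulr_natr -mulrBr => e.
    apply: contraT => mn; have /eqP := root_neq0 a; case.
    apply: tors e _; rewrite mulf_neq0 // subr_eq0.
    by rewrite eqr_nat.
  by rewrite card_ord ltnn.
move=> l; suff gl : G l = 0 by exact: subr0_eq gl.
have [k k0 [c cE]] := roots_span l.
have : G (l *~ k) = 0.
  by rewrite cE raddf_sum big1 // => b _; rewrite raddfMz g0 mul0rz.
by rewrite raddfMz mulrzz => /eqP; rewrite mulf_eq0 (negbTE k0) orbF => /eqP.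
Qed.

(** The functional [coroot a] composed with [w^-1] takes the value 2 on [w a], and its reflection
    preserves the roots, so [coroot_uniq] identifies it with the coroot of [w a]. *)
Lemma srefl_ract w a : srefl (ract w a) = (w * srefl a * w^-1)%g.
Proof.
have E l : coroot a (w^-1%g l) = coroot (ract w a) l.
  pose f : {additive lat D -> int} := coroot a \o wact w^-1%g.
  apply: (@coroot_uniq _ f) => [|b].
    by rewrite -[LHS]/(coroot a (w^-1%g (val (ract w a)))) val_ract wactK
       coroot_root.
  rewrite -[f (val b)]/(coroot a (w^-1%g (val b))).
  have := valP (ract w (ract (srefl a) (ract w^-1%g b))).
  rewrite !val_ract -[srefl a (w^-1%g (val b))]/(refl a (w^-1%g (val b))).
  by rewrite /refl wactB wactMz wactKV.
apply: weyl_eq => l.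
rewrite -[LHS]/(refl (ract w a) l) -[RHS]/(w (refl a (w^-1%g l))).
by rewrite /refl wactB wactMz wactKV val_ract E.
Qed.

(** The root [- a], written as [s_a(a)] so that it is a root by construction. *)
Definition ropp a := ract (srefl a) a.

Lemma val_ropp a : val (ropp a) = - val a.
Proof. by rewrite val_ract srefl_root. Qed.

Lemma roppK : involutive ropp.
Proof. by move=> a; apply: val_inj; rewrite !val_ropp opprK. Qed.

Lemma ract_opp w a : ract w (ropp a) = ropp (ract w a).
Proof. by apply: val_inj; rewrite val_ract !val_ropp wactN val_ract. Qed.

End Reflections.

(** * Coordinates in the simple roots and signs of roots *)

Section SimpleRoots.
Variables (D : root_datum) (P : simple_system D).
Local Notation W := (weyl D).
Local Notation idx := 'I_(srank P).
Implicit Types (u v w : W) (a b : rootset D) (i j : idx) (Xi : {set idx}).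

Definition negr a : bool := `[< neg_root P a >].

Lemma root_coef_subproof a :
  exists d : idx -> int, val a = \sum_i val (P i) *~ d i.
Proof.
have [c [->|->]] := simple_sign P a.
  by exists (fun i => (c i)%:Z); apply: eq_bigr => i _; rewrite pmulrn.
exists (fun i => - (c i)%:Z); rewrite -sumrN; apply: eq_bigr => i _.
by rewrite mulrNz pmulrn.
Qed.

Definition coef a : idx -> int := projT1 (cid (root_coef_subproof a)).

Lemma coefE a : val a = \sum_i val (P i) *~ coef a i.
Proof. exact: projT2 (cid (root_coef_subproof a)). Qed.

Lemma coef_uniq a (d : idx -> int) :
  val a = \sum_i val (P i) *~ d i -> coef a =1 d.
Proof.
move=> e i; apply: subr0_eq.
apply: (@simple_free _ P (fun i => coef a i - d i)).
under eq_bigr => j _ do rewrite mulrzBr.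
by rewrite sumrB -e -coefE subrr.
Qed.

Lemma coef_inj a b : coef a =1 coef b -> a = b.
Proof.
move=> e; apply: val_inj; rewrite !coefE.
by apply: eq_bigr => i _; rewrite e.
Qed.

Lemma coef_opp a i : coef (ropp a) i = - coef a i.
Proof.
apply: (coef_uniq (d := fun i => - coef a i)).
rewrite val_ropp {1}coefE -sumrN; apply: eq_bigr => j _.
by rewrite mulrNz.
Qed.

Lemma coef_simple i j : coef (P i) j = (j == i)%:Z.
Proof.
apply: (coef_uniq (d := fun j => (j == i)%:Z)).
rewrite (bigD1 i) //= eqxx big1 ?addr0 // => k /negbTE ->.
by rewrite mulr0z.
Qed.

Lemma coef_ract w a j :
  coef (ract w a) j = \sum_i coef a i * coef (ract w (P i)) j.
Proof.
apply: (coef_uniq (d := fun j => \sum_i coef a i * coef (ract w (P i)) j)).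
rewrite val_ract {1}coefE wact_sum.
under [RHS]eq_bigr => k _ do rewrite mulrz_sumr.
rewrite exchange_big /=; apply: eq_bigr => i _.
rewrite wactMz -val_ract {1}coefE mulrz_suml; apply: eq_bigr => k _.
by rewrite -mulrzA mulrC.
Qed.

Lemma exists_coef_neq0 a : exists i, coef a i != 0.
Proof.
apply: contrapT => h; have /eqP := root_neq0 a; apply.
rewrite coefE big1 // => i _; case: (coef a i =P 0) => [->|/eqP ne].
  by rewrite mulr0z.
by case: h; exists i.
Qed.

Lemma coef_sign a : (forall i, coef a i <= 0) \/ (forall i, 0 <= coef a i).
Proof.
have [c [e|e]] := simple_sign P a; [right|left] => i.
  have h : val a = \sum_k val (P k) *~ (c k)%:Z.
    by rewrite e; apply: eq_bigr => k _; rewrite pmulrn.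
  by rewrite (coef_uniq h).
have h : val a = \sum_k val (P k) *~ - (c k)%:Z.
  by rewrite e -sumrN; apply: eq_bigr => k _; rewrite mulrNz pmulrn.
by rewrite (coef_uniq h) oppr_le0.
Qed.

Lemma negrP a : reflect (forall i, coef a i <= 0) (negr a).
Proof.
apply: (iffP (asboolP _)) => [[c e] i|h].
  have h : val a = \sum_k val (P k) *~ - (c k)%:Z.
    by rewrite e -sumrN; apply: eq_bigr => k _; rewrite mulrNz pmulrn.
  by rewrite (coef_uniq h) oppr_le0.
exists (fun i => `|coef a i|%N); rewrite {1}coefE -sumrN.
apply: eq_bigr => i _; rewrite pmulrn -mulrNz; congr (_ *~ _).
by have := h i; lia.
Qed.

Lemma posrP a : reflect (forall i, 0 <= coef a i) (~~ negr a).
Proof.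
apply: (iffP idP) => [n i|h].
  by have [/negrP|] := coef_sign a; rewrite ?(negbTE n).
apply/negP => /negrP h'; have [i] := exists_coef_neq0 a.
by case/eqP; apply: le_anti; rewrite h h'.
Qed.

Lemma negr_opp a : negr (ropp a) = ~~ negr a.
Proof.
apply/negrP/posrP => h i; have := h i; rewrite coef_opp.
  by rewrite oppr_le0.
by rewrite oppr_le0.
Qed.

Lemma simple_pos i : negr (P i) = false.
Proof. by apply/negbTE/posrP => j; rewrite coef_simple. Qed.

Lemma coef_srefl i a j : j != i -> coef (ract (srefl (P i)) a) j = coef a j.
Proof.
move=> ji; pose d j := coef a j - (j == i)%:Z * coroot (P i) (val a).
rewrite (coef_uniq (d := d)) /d ?(negbTE ji) ?mul0r ?subr0 //.
rewrite val_ract -[LHS]/(refl (P i) (val a)) /refl {1}coefE.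
under [RHS]eq_bigr => k _ do rewrite mulrzBr.
rewrite sumrB; congr (_ - _).
rewrite (bigD1 i) //= eqxx mul1r big1 ?addr0 // => k /negbTE ->.
by rewrite mul0r mulr0z.
Qed.

(* A positive root made negative by [s_i] is a multiple of [P i], and it is
   reducedness that excludes the multiple 2. *)
Lemma negr_srefl i a : a != P i -> ~~ negr a -> ~~ negr (ract (srefl (P i)) a).
Proof.
move=> ne pa; apply/negP => na; case/eqP: ne; apply: coef_inj => j.
have c0 k : k != i -> coef a k = 0.
  move=> ki; apply: le_anti; rewrite (posrP _ pa) andbT.
  by rewrite -(coef_srefl _ ki) (negrP _ na).
have va : val a = val (P i) *~ coef a i.
  by rewrite {1}coefE (bigD1 i) //= big1 ?addr0 // => k /c0 ->; rewrite mulr0z.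
rewrite coef_simple; have [->|/c0 //] := eqVneq j i.
have := posrP _ pa i.
have := coroot_root a; rewrite {1}va raddfMz mulrzz.
case: (coef a i =P 2) => [e|ne2 e].
  by have := root2 (P i); rewrite pmulrn -[2%:Z]e -va (valP a).
have {e} : ((coroot a (val (P i)) : int) * coef a i = 2)%R by [].
move: (coroot a _ : int) (coef a i) ne2 => x y ne2 e y0.
have [x0|x1] : (x <= 0)%R \/ (1 <= x)%R by lia.
  by nia.
have y2 : (y <= 2)%R by nia.
have : y = 0 \/ y = 1 by lia.
by case=> // y00; move: e; rewrite y00; lia.
Qed.

Lemma negr_srefl_eq i a : ~~ negr a -> negr (ract (srefl (P i)) a) = (a == P i).
Proof.
move=> pa; have [->|ne] := eqVneq a (P i).
  by rewrite -[ract _ _]/(ropp (P i)) negr_opp simple_pos.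
by apply/negbTE; apply: negr_srefl.
Qed.

Lemma negr_srefl_ne i a : a != P i -> a != ropp (P i) ->
  negr (ract (srefl (P i)) a) = negr a.
Proof.
move=> ne ne'; case: (boolP (negr a)) => na; last first.
  by rewrite negr_srefl_eq // (negbTE ne).
rewrite -[a]roppK ract_opp negr_opp negr_srefl ?negr_opp ?negbK //.
by apply: contraNneq ne' => <-; rewrite roppK.
Qed.

End SimpleRoots.

(** * Words, lengths and parabolic subgroups *)

Section Length.
Variables (D : root_datum) (P : simple_system D).
Local Notation W := (weyl D).
Local Notation idx := 'I_(srank P).
Local Notation s_ i := (srefl (P i)).
Implicit Types (u v w : W) (a b : rootset D) (i j k : idx) (Xi : {set idx}).
Implicit Types (J : seq idx).

Lemma sword_nil : sword ([::] : seq idx) = 1%g.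
Proof. exact: big_nil. Qed.

Lemma sword_cons i J : sword (i :: J) = (s_ i * sword J)%g.
Proof. exact: big_cons. Qed.

Lemma sword_cat J J' : sword (J ++ J') = (sword J * sword J')%g.
Proof. exact: big_cat. Qed.

Lemma sword_rcons J i : sword (rcons J i) = (sword J * s_ i)%g.
Proof. by rewrite -cats1 sword_cat sword_cons sword_nil mulg1. Qed.

Lemma sword_rev J : sword (rev J) = (sword J)^-1%g.
Proof.
elim: J => [|i J IH]; first by rewrite sword_nil invg1.
by rewrite rev_cons sword_rcons sword_cons invMg sreflV IH.
Qed.

(** Reading the word from the right, [P k] first becomes negative at a letter [i] where its image is
    [P i]. Then [s_i] is the conjugate of [s_k] by the tail, and multiplying by [s_k] deletes this
    letter. *)
Lemma exchange J k : negr P (ract (sword J) (P k)) ->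
  exists2 J' : seq idx, sword J' = (sword J * s_ k)%g & size J = (size J').+1.
Proof.
elim: J => [|i J IH]; first by rewrite sword_nil ract1 simple_pos.
rewrite sword_cons ractM; case: (boolP (negr P (ract (sword J) (P k)))).
  by case/IH=> J' e s _; exists (i :: J'); rewrite /= ?s // sword_cons e mulgA.
move=> pos; rewrite negr_srefl_eq // => /eqP e; exists J => //.
by rewrite -e srefl_ract mulgKV -mulgA srefl2 mulg1.
Qed.

(** [len] is an [xget] with default 0; for an element given by a word the defining set is inhabited,
    so [len] is a true minimum. *)
Lemma lenP J : (exists2 J' : seq idx, sword J' = sword J & size J' = len P
  (sword J)) /\
  (forall J' : seq idx, sword J' = sword J -> (len P (sword J) <= size J')%N).
Proof.
rewrite /len; set A := (X in classical_sets.xget _ X).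
suff ex : exists l, A l by exact: (classical_sets.xgetPex 0%N ex).
pose p l : bool := `[< exists2 J' : seq idx, sword J' = sword J & size J' = l
  >].
have exp : exists l, p l by exists (size J); apply/asboolP; exists J.
exists (ex_minn exp); case: ex_minnP => l /asboolP pl min; split=> // J' e.
by apply: min; apply/asboolP; exists J'.
Qed.

Lemma len_sword J : (len P (sword J) <= size J)%N.
Proof. by have [_ ->] := lenP J. Qed.

Lemma parabolic_ind Xi (K : W -> Prop) : K 1%g ->
    (forall w i, i \in Xi -> w \in parabolic Xi -> K w -> K (s_ i * w)%g) ->
  forall w, w \in parabolic Xi -> K w.
Proof.
move=> K1 KM w /gen_prodgP[n [c cXi ->]].
suff [//] : K (\prod_(i < n) c i)%g /\ (\prod_(i < n) c i)%g \in parabolic Xi.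
elim: n c cXi => [|n IH] c cXi; first by rewrite big_ord0 group1.
rewrite big_ord_recl; have /imsetP[i iXi e] := cXi ord0.
have [Kw wXi] := IH (fun m => c (lift ord0 m)) (fun m => cXi _).
rewrite e; split; first exact: KM.
by rewrite groupM //; apply: mem_gen; apply: imset_f.
Qed.

Lemma srefl_parabolic Xi i : i \in Xi -> s_ i \in parabolic Xi.
Proof. by move=> iXi; apply: mem_gen; apply: imset_f. Qed.

Lemma parabolicS Xi Xi' : Xi' \subset Xi -> parabolic Xi' \subset parabolic Xi.
Proof. by move=> h; apply/genS/imsetS. Qed.

Lemma coef_ract_parabolic Xi w a j : w \in parabolic Xi -> j \notin Xi ->
  coef (ract w a) j = coef a j.
Proof.
move=> wXi jXi; elim/parabolic_ind: w / wXi => [|w i iXi _ IH].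
  by rewrite ract1.
by rewrite ractM coef_srefl ?IH //; apply: contraNneq jXi => ->.
Qed.

(** [s_a] negates [a] but, lying in [W_Xi], leaves the coefficient at [j] unchanged. *)
Lemma coef_parabolic0 Xi a j :
  srefl a \in parabolic Xi -> j \notin Xi -> coef a j = 0.
Proof.
move=> aXi jXi; have := coef_ract_parabolic a aXi jXi.
rewrite -/(ropp a) coef_opp; move: (coef a j) => x; lia.
Qed.

Lemma neg_ract_parabolic_in Xi v k :
  v \in parabolic Xi -> negr P (ract v (P k)) -> k \in Xi.
Proof.
move=> vXi n; apply: contraLR n => kXi; apply/negP => /negrP/(_ k).
by rewrite (coef_ract_parabolic _ vXi kXi) coef_simple eqxx.
Qed.

(** Each coefficient of [w a] is a sum of products of a coefficient of [a] and one of some [w(P i)],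
    all of the same sign. The factors 1 and -1 treat the four sign patterns together. *)
Lemma negr_ract_span w Xi a (s : bool) :
    (forall i, i \notin Xi -> coef a i = 0) ->
    (forall i, i \in Xi -> negr P (ract w (P i)) = s) ->
  negr P (ract w a) = s (+) negr P a.
Proof.
move=> aXi ws.
have c i j : 0 <= coef a i * (if negr P a then -1 else 1) *
    (coef (ract w (P i)) j * (if s then -1 else 1)).
  have [iXi|/aXi ->] := boolP (i \in Xi); last by rewrite !mul0r.
  apply: mulr_ge0.
    by case: ifP => [/negrP/(_ i)|/negbT/posrP/(_ i)]; lia.
  by rewrite -(ws i iXi); case: ifP => [/negrP/(_ j)|/negbT/posrP/(_ j)]; lia.
have {}c j : 0 <= coef (ract w a) j * (if negr P a then -1 else 1) *
    (if s then -1 else 1).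
  rewrite coef_ract !mulr_suml; apply: sumr_ge0 => i _.
  by have := c i j; case: ifP => _; case: ifP => _; lia.
case: s {ws} c; case: (boolP (negr P a)) => _ c /=.
- by apply/negbTE/posrP => j; have := c j; lia.
- by apply/negrP => j; have := c j; lia.
- by apply/negrP => j; have := c j; lia.
- by apply/negbTE/posrP => j; have := c j; lia.
Qed.

Lemma srefl_opp a : srefl (ropp a) = srefl a.
Proof. by rewrite srefl_ract mulgK. Qed.

Lemma srefl_ract_parabolic Xi w a : w \in parabolic Xi ->
  (srefl (ract w a) \in parabolic Xi) = (srefl a \in parabolic Xi).
Proof. by move=> wXi; rewrite srefl_ract groupMr ?groupV // groupMl. Qed.

(** A generator [s_i] changes only the signs of [P i] and its negative, and their reflection lies in
    [W_Xi]. *)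
Lemma negr_ract_parabolic Xi w a : w \in parabolic Xi ->
  srefl a \notin parabolic Xi -> negr P (ract w a) = negr P a.
Proof.
move=> wXi aXi; elim/parabolic_ind: w / wXi => [|w i iXi wXi IH].
  by rewrite ract1.
set b := ract w a in IH *.
have bXi : srefl b \notin parabolic Xi by rewrite srefl_ract_parabolic.
have ne c : srefl c \notin parabolic Xi -> c != P i.
  by apply: contraNneq => ->; apply: srefl_parabolic.
rewrite ractM -/b -IH; case: (boolP (negr P b)) => nb.
  rewrite -[b]roppK ract_opp negr_opp negr_srefl // ?negr_opp ?negbK //.
  by rewrite ne // srefl_opp.
by apply/negbTE; rewrite negr_srefl // ne.
Qed.

Lemma neg_parabolicE Xi a :
  neg_parabolic Xi a = negr P a && (srefl a \in parabolic Xi).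
Proof. by []. Qed.

(** The inversion set of [w^-1]; its roots index the denominators of the leading coefficient of
    [X_(I_w)]. *)
Definition invs w : {set rootset D} :=
  [set a | ~~ negr P a & negr P (ract w^-1%g a)].

Section Words.
Variables (I : W -> seq idx) (hI : forall w, reduced_seq w (I w)).

Lemma sword_reduced w : sword (I w) = w.
Proof. by case: (hI w). Qed.

Lemma size_reduced w : size (I w) = len P w.
Proof. by case: (hI w). Qed.

Lemma len_min J w : sword J = w -> (len P w <= size J)%N.
Proof. by move=> <-; apply: len_sword. Qed.

Lemma len1 : len P 1%g = 0%N.
Proof. by apply/eqP; rewrite -leqn0; apply: (@len_min ([::] : seq idx));
  apply: sword_nil. Qed.

Lemma len_eq0 w : (len P w == 0%N) = (w == 1%g).
Proof.
apply/eqP/eqP => [|->]; last exact: len1.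
by rewrite -size_reduced => /size0nil e; rewrite -(sword_reduced w) e sword_nil.
Qed.

Lemma lenM u v : (len P (u * v)%g <= len P u + len P v)%N.
Proof.
rewrite -(size_reduced u) -(size_reduced v) -size_cat; apply: len_min.
by rewrite sword_cat !sword_reduced.
Qed.

Lemma lenV w : len P w^-1%g = len P w.
Proof.
have le u : (len P u^-1%g <= len P u)%N.
  rewrite -(size_reduced u) -size_rev; apply: len_min.
  by rewrite sword_rev sword_reduced.
by apply/eqP; rewrite eqn_leq le -{1}[w]invgK le.
Qed.

Lemma len_gtM_srefl w k :
  negr P (ract w (P k)) -> (len P (w * s_ k)%g < len P w)%N.
Proof.
have := @exchange (I w) k; rewrite sword_reduced size_reduced => h /h[J e ->].
by rewrite ltnS -e len_sword.
Qed.

(** If [w(P k)] is positive, then [w s_k] sends [P k] to a negative root, and the exchange property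
    applies to [w s_k] instead. *)
Lemma len_ltM_srefl w k :
  (len P w < len P (w * s_ k)%g)%N = ~~ negr P (ract w (P k)).
Proof.
case: (boolP (negr P _)) => [/len_gtM_srefl|] n; first by rewrite ltnNge ltnW.
rewrite -{1}[w](mulgK (s_ k)) sreflV len_gtM_srefl // ractM -/(ropp (P k)).
by rewrite ract_opp negr_opp.
Qed.

Lemma min_repsP Xi u :
  reflect (forall i, i \in Xi -> negr P (ract u (P i)) = false)
          (u \in min_reps Xi).
Proof.
rewrite inE; apply: (iffP forall_inP) => h i /h; rewrite len_ltM_srefl.
  by move/negbTE.
by move->.
Qed.

Lemma reduced_tail i J : size (i :: J) = len P (sword (i :: J)) ->
  size J = len P (sword J).
Proof.
move=> e; apply/eqP; rewrite eqn_leq len_sword andbT -ltnS -[X in (X <=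
  _)%N]/(size (i :: J)).
rewrite e sword_cons; apply: leq_trans (lenM _ _) _.
by rewrite -add1n leq_add2r; apply: (@len_min [:: i]);
  rewrite sword_cons sword_nil mulg1.
Qed.

(** This recursion drives both the count of inversions and the computation of the leading
    coefficients. *)
Lemma invs_cons i J : size (i :: J) = len P (sword (i :: J)) ->
  invs (sword (i :: J)) = P i |: [set ract (s_ i) a | a in invs (sword J)] /\
  P i \notin [set ract (s_ i) a | a in invs (sword J)].
Proof.
move=> red; have redJ := reduced_tail red.
move: red redJ; rewrite sword_cons; set w := sword J => red redJ.
(* Reducedness means that [s_i] lengthens [w] from the left, hence lengthens [w^-1] from the
   right. *)
have pos : ~~ negr P (ract w^-1%g (P i)).
  by rewrite -len_ltM_srefl -(lenV (w^-1 * _)%g) invMg sreflV invgK lenV -red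
    -redJ.
have sPi : ract (s_ i) (P i) = ropp (P i) by [].
split; last first.
  apply/imsetP => -[a]; rewrite inE => /andP[pa _] e.
  have ea : a = ropp (P i).
    by rewrite -sPi [X in ract _ X]e -ractM srefl2 ract1.
  by move: pa; rewrite ea negr_opp simple_pos.
apply/setP => a; rewrite !inE; have [->|ne] := eqVneq a (P i) => /=.
  by rewrite simple_pos /= invMg sreflV ractM sPi ract_opp negr_opp pos.
apply/andP/imsetP => [[pa na]|[b]].
  exists (ract (s_ i) a); last by rewrite -ractM srefl2 ract1.
  rewrite inE negr_srefl //=.
  by move: na; rewrite invMg sreflV ractM.
rewrite inE => /andP[pb nb] ->;
  rewrite invMg sreflV ractM -[ract (s_ i) (ract _ b)]ractM srefl2 ract1.
split=> //; apply: negr_srefl => //; apply: contraTneq nb => ->.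
by rewrite (negbTE pos).
Qed.

Lemma card_invs w : #|invs w| = len P w.
Proof.
rewrite -{1}(sword_reduced w) -size_reduced.
have : size (I w) = len P (sword (I w)) by rewrite sword_reduced size_reduced.
elim: (I w) => [|i J IH] red.
  apply/eqP; rewrite sword_nil cards_eq0; apply/eqP/setP => a.
  by rewrite !inE invg1 ract1 andNb.
have [-> notin] := invs_cons red.
rewrite cardsU1 notin card_imset ?IH //; last exact: ract_inj.
exact: reduced_tail red.
Qed.

Lemma longest_parabolic Xi : exists2 v0, v0 \in parabolic Xi &
  (forall i, i \in Xi -> negr P (ract v0 (P i)) = true) /\
  (forall v, v \in parabolic Xi -> (len P v <= len P v0)%N).
Proof.
have [v0 v0Xi max] := @arg_maxnP _ 1%g (mem (parabolic Xi)) (len P) (group1 _).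
exists v0 => //; split=> // i iXi; apply: contraT.
rewrite -len_ltM_srefl ltnNge => /negP[]; apply: max => /=.
by rewrite groupM ?srefl_parabolic.
Qed.

(** As [w0] exchanges positive and negative roots, the roots counted by [w0 x] correspond, via [b]
    to [w0(- b)], to the positive roots not counted by [x]. *)
Lemma len_longestM w0 x : (forall a, negr P (ract w0 a) = ~~ negr P a) ->
  (len P (w0 * x)%g + len P x)%N = #|[set a | ~~ negr P a]|.
Proof.
move=> hw0; rewrite -!card_invs.
have hw0V a : negr P (ract w0^-1%g a) = ~~ negr P a.
  by rewrite -{2}[a](ractKV w0) hw0 negbK.
have -> : invs (w0 * x)%g =
    [set ract w0 (ropp b) | b in [set a | ~~ negr P a] :\: invs x].
  apply/setP => a; rewrite inE invMg ractM.
  apply/andP/imsetP => [[pa na]|[b]].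
    exists (ropp (ract w0^-1%g a)); last by rewrite roppK ractKV.
    by rewrite !inE !negr_opp hw0V ract_opp negr_opp pa na.
  rewrite !inE => /andP[]; rewrite negb_and negbK => /orP[->//|nb] pb ->.
  by rewrite hw0 negr_opp negbK pb ractK ract_opp negr_opp.
rewrite card_imset => [|a b /ract_inj/(can_inj (@roppK D))//].
rewrite addnC -(cardsID (invs x) [set a | ~~ negr P a]); congr (_ + _)%N.
by apply: eq_card => a; rewrite !inE andbA andbb.
Qed.

Lemma parabolicT : parabolic [set: idx] = [set: W].
Proof.
apply/eqP; rewrite -subTset; apply/subsetP => w _.
rewrite -(sword_reduced w) /sword; apply: group_prod => i _.
by apply: srefl_parabolic; rewrite inE.
Qed.

(** The shortest element of [w W_Xi] serves as [u]: a descent in [Xi] would give a shorter one. *)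
Lemma min_reps_factor Xi w :
  exists u v, [/\ u \in min_reps Xi, v \in parabolic Xi & w = (u * v)%g].
Proof.
have [v vXi min] := @arg_minnP _ 1%g (mem (parabolic Xi))
  (fun v => len P (w * v)%g) (group1 _).
exists (w * v)%g, v^-1%g; split; rewrite ?groupV ?mulgK //.
apply/min_repsP => i iXi; apply/negbTE/negP => /len_gtM_srefl.
rewrite ltnNge -mulgA => /negP[]; apply: min => /=.
by rewrite groupM ?srefl_parabolic.
Qed.

End Words.
End Length.

(** * The Weyl group action on the localized formal group algebra *)

Local Open Scope quotient_scope.

Section Renaming.
Variables (I : choiceType) (R : comNzRingType).
Implicit Types (w v : I -> I) (m : {cmonom I}).

(** A bijective renaming only permutes exponents, so monomials do not merge. Functoriality of
    [ps_rename], and with it of the action on [Q], rests on this. *)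
Lemma mon_renameE w w' m i : cancel w w' -> cancel w' w ->
  mon_rename w m i = m (w' i).
Proof.
move=> wK w'K; have itE k j : (iterop k mmul (ucm j) mone : {cmonom I}) i =
    (k * (j == i))%N.
  elim: k => [|k IH]; first by rewrite cm1.
  have -> : iterop k.+1 mmul (ucm j) mone =
      mmul (ucm j) (iterop k mmul (ucm j) mone).
    by case: {IH} k => //=; rewrite mulm1.
  by rewrite cmM IH cmU mulSn.
rewrite /mon_rename (big_morph (fun m : {cmonom I} => m i)
  (fun m1 m2 => cmM i m1 m2) (cm1 i)).
under eq_bigr => j _ do rewrite itE (can2_eq wK w'K).
have [wi|wi] := boolP (w' i \in finsupp m); last first.
  rewrite (fsfun_dflt wi) big1_seq // => j /= jm.
  case: eqP => [e|_]; last by rewrite muln0.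
  by rewrite -e jm in wi.
rewrite (big_fsetD1 _ wi) /= eqxx muln1 big1_seq ?addn0 // => j /=.
by rewrite in_fsetD1 => /andP[/negbTE -> _]; rewrite muln0.
Qed.

Lemma mcoeff_pol_rename w w' (p : {malg R[{cmonom I}]}) m :
  cancel w w' -> cancel w' w -> (pol_rename w p)@_m = p@_(mon_rename w' m).
Proof.
move=> wK w'K; rewrite /pol_rename raddf_sum /=.
under eq_bigr => n _ do rewrite mcoeffU.
have e n : (mon_rename w n == m) = (n == mon_rename w' m).
  apply/cmP/cmP => h i.
    by rewrite (mon_renameE _ _ w'K wK) -h (mon_renameE _ _ wK w'K) wK.
  by rewrite (mon_renameE _ _ wK w'K) h (mon_renameE _ _ w'K wK) w'K.
under eq_bigr => n _ do rewrite e.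
have [im|im] := boolP (mon_rename w' m \in msupp p); last first.
  rewrite (mcoeff_outdom im) big1_seq // => n /= nm.
  case: eqP => [e'|_]; last by rewrite mulr0n.
  by rewrite -e' nm in im.
rewrite (big_fsetD1 _ im) /= eqxx mulr1n big1_seq ?addr0 // => n /=.
by rewrite in_fsetD1 => /andP[/negbTE -> _]; rewrite mulr0n.
Qed.

Lemma ps_rename_comp v v' w w' (f : pseries I R) :
    cancel v v' -> cancel v' v -> cancel w w' -> cancel w' w ->
  ps_rename v (ps_rename w f) = ps_rename (v \o w) f.
Proof.
move=> vK v'K wK w'K; apply: pseriesP => d /=; apply/malgP => m.
have vwK : cancel (v \o w) (w' \o v') by exact: can_comp.
have wvK : cancel (w' \o v') (v \o w) by exact: can_comp.
apply: etrans (mcoeff_pol_rename _ _ vK v'K) _.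
apply: etrans (mcoeff_pol_rename _ _ wK w'K) _.
apply: etrans _ (esym (mcoeff_pol_rename _ _ vwK wvK)); congr (_ @_ _).
apply/eqP/cmP => i; rewrite (mon_renameE _ _ w'K wK).
by rewrite (mon_renameE _ _ v'K vK) (mon_renameE _ _ wvK vwK).
Qed.

Lemma ps_rename_id (f : pseries I R) : ps_rename id f = f.
Proof.
apply: pseriesP => d /=; apply/malgP => m.
rewrite (@mcoeff_pol_rename id id) //; congr (_ @_ _).
by apply/eqP/cmP => i; rewrite (@mon_renameE id id).
Qed.

End Renaming.

Lemma pol_rename0 (I : choiceType) (R : comNzRingType) (w : I -> I) :
  pol_rename w (0 : {malg R[{cmonom I}]}) = 0.
Proof. by rewrite /pol_rename msupp0 big_seq_fset0. Qed.

Lemma pol_renameU (I : choiceType) (R : comNzRingType) (w w' : I -> I) i :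
  cancel w w' -> cancel w' w ->
  pol_rename w (<< ucm i >> : {malg R[{cmonom I}]}) = << ucm (w i) >>.
Proof.
move=> wK w'K; apply/malgP => m.
apply: etrans (mcoeff_pol_rename _ _ wK w'K) _.
apply: etrans (mcoeffU _ _ _) _; apply: etrans _ (esym (mcoeffU _ _ _)).
congr (_ *+ nat_of_bool _); apply/cmP/cmP => h j.
  rewrite cmU -[in RHS](w'K j) -(mon_renameE _ _ w'K wK) -h cmU.
  by rewrite (can2_eq wK w'K).
by rewrite (mon_renameE _ _ w'K wK) -h !cmU (can_eq wK).
Qed.

Lemma ps_rename_var (I : choiceType) (R : comNzRingType) (w w' : I -> I) i :
  cancel w w' -> cancel w' w -> ps_rename w (ps_var R i) = ps_var R (w i).
Proof.
move=> wK w'K; apply: pseriesP => d.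
change (pol_rename w (if d == 1%N then << ucm i >> else 0
          : {malg R[{cmonom I}]}) = if d == 1%N then << ucm (w i) >> else 0).
case: (d == 1%N); first exact: pol_renameU wK w'K.
exact: pol_rename0.
Qed.

(** * Integral elements and the action on [Q] *)

Section LocalizedAction.
Variables (R : comNzRingType) (F : fgl R) (D : root_datum).
Variable Q : localized_fga F D.
Local Notation W := (weyl D).
Local Notation S := (fga F (lat D)).
Local Notation act := (loc_act Q).
Local Notation x_ a := (xroot Q a).
Implicit Types (u v w : W) (a b : rootset D) (q : loc Q).

Lemma fga_projK (s : S) : fga_proj F (repr s) = s.
Proof. exact: reprK. Qed.

Lemma unit_xroot a : x_ a \is a GRing.unit.
Proof. exact: loc_unit. Qed.

Lemma act_xroot w a : act w (x_ a) = x_ (ract w a).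
Proof.
rewrite /xroot loc_actE (ps_rename_var _ _ (wactK w) (wactKV w)).
by rewrite val_ract.
Qed.

Definition integral q : Prop := exists s, q = loc_in Q s.

Lemma integral0 : integral 0. Proof. by exists 0; rewrite rmorph0. Qed.

Lemma integral1 : integral 1. Proof. by exists 1; rewrite rmorph1. Qed.

Lemma integralN p : integral p -> integral (- p).
Proof. by case=> s ->; exists (- s); rewrite rmorphN. Qed.

Lemma integralD p q : integral p -> integral q -> integral (p + q).
Proof. by case=> s -> [t ->]; exists (s + t); rewrite rmorphD. Qed.

Lemma integralM p q : integral p -> integral q -> integral (p * q).
Proof. by case=> s -> [t ->]; exists (s * t); rewrite rmorphM. Qed.

Lemma integral_sum (J : finType) (A : {pred J}) (E : J -> loc Q) :
  (forall j, j \in A -> integral (E j)) -> integral (\sum_(j in A) E j).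
Proof.
by move=> h; elim/big_ind: _ => //; [apply: integral0 | apply: integralD].
Qed.

Lemma integral_act w q : integral q -> integral (act w q).
Proof.
by case=> s ->; exists (fga_proj F (ps_rename w (repr s)));
  rewrite -{1}[s]fga_projK loc_actE.
Qed.

(** Elements of [Q] are fractions whose denominators are products of [x_a]; both maps agree on these
    denominators and send them to units. *)
Lemma eq_loc_rmorph (f g : {rmorphism loc Q -> loc Q}) :
  (forall s, f (loc_in Q s) = g (loc_in Q s)) -> f =1 g.
Proof.
move=> fg q; have [s [r e]] := loc_frac q.
have u : f (\prod_(a <- r) x_ a) \is a GRing.unit.
  by apply: rmorph_unit; apply: rpred_prod => a _; apply: unit_xroot.
have fgr : f (\prod_(a <- r) x_ a) = g (\prod_(a <- r) x_ a).
  by rewrite -rmorph_prod fg.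
by apply: (mulIr u); rewrite {2}fgr -!rmorphM e.
Qed.

Lemma loc_act1 : act 1%g =1 id.
Proof.
apply: (@eq_loc_rmorph _ idfun) => s /=.
by rewrite -[s]fga_projK loc_actE ps_rename_id.
Qed.

Lemma loc_actM u v q : act (u * v)%g q = act u (act v q).
Proof.
apply: (@eq_loc_rmorph _ (act u \o act v)) => s /=.
rewrite -[s]fga_projK !loc_actE.
by rewrite (ps_rename_comp _ (wactK u) (wactKV u) (wactK v) (wactKV v)).
Qed.

Lemma loc_actK w : cancel (act w) (act w^-1%g).
Proof. by move=> q; rewrite -loc_actM mulVg loc_act1. Qed.

Lemma loc_actKV w : cancel (act w^-1%g) (act w).
Proof. by move=> q; rewrite -loc_actM mulgV loc_act1. Qed.

Lemma act_unit w q : q \is a GRing.unit -> act w q \is a GRing.unit.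
Proof. exact: rmorph_unit. Qed.

Lemma unit_prod_xroot (A : {pred rootset D}) (h : rootset D -> rootset D) :
  \prod_(a in A) x_ (h a) \is a GRing.unit.
Proof. by apply: rpred_prod => a _; apply: unit_xroot. Qed.

(** An element of the kernel is killed by a product of [x_a], whose factors are cancelled one at a
    time by regularity. *)
Lemma loc_in_inj : (forall (a : rootset D) (s : S),
    fga_var F (val a) * s = 0 -> s = 0) -> injective (loc_in Q).
Proof.
move=> reg s t /eqP; rewrite -subr_eq0 -rmorphB => /eqP/loc_eq0[r e].
apply: subr0_eq; move: (s - t) e => {s t} s.
elim: r => [|a r IH]; first by rewrite big_nil mulr1.
by rewrite big_cons mulrCA => /reg.
Qed.

End LocalizedAction.

(** * The twisted group algebra and its dual *)

Section TwistedAlgebra.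
Variables (R : comNzRingType) (F : fgl R) (D : root_datum).
Variables (P : simple_system D) (Q : localized_fga F D).
Local Notation W := (weyl D).
Local Notation idx := 'I_(srank P).
Local Notation act := (loc_act Q).
Local Notation x_ a := (xroot Q a).
Local Notation s_ i := (srefl (P i)).
Local Notation X_ := (Defs.X_ Q).
Implicit Types (u v w : W) (a b : rootset D) (q : loc Q) (z : QW Q).
Implicit Types (f g h : QWdual Q) (i k : idx) (J : seq idx).

Definition dval f w : loc Q := f (delta Q w).

Lemma qw_sum_delta z : z = \sum_w z w *: delta Q w.
Proof.
apply/ffunP => u; rewrite sum_ffunE (bigD1 u) //= !ffunE eqxx.
rewrite [X in X + _]mulr1 big1 ?addr0 // => w ne.
by rewrite !ffunE eq_sym (negbTE ne) [LHS]mulr0.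
Qed.

Lemma dual_sumE f z : f z = \sum_w z w * dval f w.
Proof.
rewrite {1}[z]qw_sum_delta linear_sum; apply: eq_bigr => w _.
by rewrite linearZ.
Qed.

Lemma dvalP f g : dval f =1 dval g -> f = g.
Proof.
by move=> e; apply/lfunP => z; rewrite !dual_sumE; apply: eq_bigr => w _;
  rewrite e.
Qed.

Lemma dualD f g z : (f + g) z = f z + g z. Proof. exact: add_lfunE. Qed.

Lemma dualZ q f z : (q *: f) z = q * f z. Proof. exact: scale_lfunE. Qed.

Lemma dual_sum (J : finType) (A : pred J) (E : J -> QWdual Q) z :
  (\sum_(j | A j) E j) z = \sum_(j | A j) E j z.
Proof. exact: sum_lfunE. Qed.

Lemma dval0 w : dval 0 w = 0. Proof. by rewrite /dval zero_lfunE. Qed.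

Lemma dvalB f g w : dval (f - g) w = dval f w - dval g w.
Proof. by rewrite /dval add_lfunE opp_lfunE. Qed.

Lemma dvalZ q f w : dval (q *: f) w = q * dval f w.
Proof. by rewrite /dval scale_lfunE. Qed.

Lemma dval_sum (J : finType) (A : pred J) (E : J -> QWdual Q) w :
  dval (\sum_(j | A j) E j) w = \sum_(j | A j) dval (E j) w.
Proof. by rewrite /dval sum_lfunE. Qed.

Lemma qw_mulE z z' u :
  qw_mul z z' u = \sum_w z w * act w (z' (w^-1 * u)%g).
Proof.
rewrite /qw_mul sum_ffunE; apply: eq_bigr => w _.
rewrite sum_ffunE (bigD1 (w^-1 * u)%g) //= !ffunE mulKVg eqxx.
rewrite [X in X + _]mulr1 big1 ?addr0 // => w' ne.
rewrite !ffunE; case: eqP => [e|_]; last by rewrite [LHS]mulr0.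
by rewrite e mulKg eqxx in ne.
Qed.

Lemma qw_mul_delta v z u : qw_mul (delta Q v) z u = act v (z (v^-1 * u)%g).
Proof.
rewrite qw_mulE (bigD1 v) //= ffunE eqxx mul1r big1 ?addr0 // => w ne.
by rewrite ffunE (negbTE ne) mul0r.
Qed.

Lemma qw_mul1 z : qw_mul (delta Q 1%g) z = z.
Proof. by apply/ffunP => u; rewrite qw_mul_delta loc_act1 invg1 mul1g. Qed.

Lemma qw_mulA z z' z'' : qw_mul z (qw_mul z' z'') = qw_mul (qw_mul z z') z''.
Proof.
apply/ffunP => u; rewrite !qw_mulE.
under eq_bigr => w _ do rewrite qw_mulE rmorph_sum mulr_sumr.
under [RHS]eq_bigr => w _ do rewrite qw_mulE mulr_suml.
rewrite [RHS]exchange_big; apply: eq_bigr => w _.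
rewrite [RHS](reindex_inj (mulgI w)); apply: eq_bigr => w' _.
by rewrite mulKg rmorphM -loc_actM mulrA invMg mulgA.
Qed.

Lemma qw_mul_is_linear z' : linear (fun z => qw_mul z z').
Proof.
move=> q z1 z2; apply/ffunP => u; rewrite !ffunE !qw_mulE.
rewrite scaler_sumr -big_split; apply: eq_bigr => w _.
by rewrite !ffunE mulrDl; congr (_ + _); apply: esym (mulrA _ _ _).
Qed.

(** [linfun] computes as the given function only once that function is known to be linear, so
    linearity is packed into a structure first. *)
Lemma dual_actE z f z' : dual_act z f z' = f (qw_mul z' z).
Proof.
have lin : linear (fun z' : QW Q => f (qw_mul z' z)).
  by move=> q z1 z2; rewrite qw_mul_is_linear linearP.
pose m := GRing.isLinear.Build _ _ _ _ _ lin.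
pose g : {linear QW Q -> (loc Q)^o} := HB.pack (fun z' : QW Q =>
  f (qw_mul z' z)) m.
exact: (lfunE g).
Qed.

Lemma dval_act z f v :
  dval (dual_act z f) v = \sum_w act v (z w) * dval f (v * w)%g.
Proof.
rewrite /dval dual_actE dual_sumE (reindex_inj (mulgI v)).
by apply: eq_bigr => w _; rewrite qw_mul_delta mulKg.
Qed.

Lemma dual_act0 z : dual_act z (0 : QWdual Q) = 0.
Proof. by apply/lfunP => y; rewrite dual_actE !zero_lfunE. Qed.

Lemma dval_act_delta u f v : dval (dual_act (delta Q u) f) v = dval f (v * u)%g.
Proof.
rewrite dval_act (bigD1 u) //= ffunE eqxx rmorph1 mul1r big1 ?addr0 // => w ne.
by rewrite ffunE (negbTE ne) rmorph0 mul0r.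
Qed.

Lemma dval_fdelta u v : dval (fdelta Q u) v = (v == u)%:R.
Proof.
have lin : linear (fun z : QW Q => z u : (loc Q)^o) by move=> q z1 z2;
  rewrite !ffunE.
pose m := GRing.isLinear.Build _ _ _ _ _ lin.
pose g : {linear QW Q -> (loc Q)^o} := HB.pack (fun z : QW Q =>
  z u : (loc Q)^o) m.
by rewrite /dval [LHS](lfunE g) /= ffunE eq_sym.
Qed.

Definition dual_of (c : W -> loc Q) : QWdual Q := \sum_w c w *: fdelta Q w.

Lemma dval_dual_of c w : dval (dual_of c) w = c w.
Proof.
rewrite dval_sum (bigD1 w) //= dvalZ dval_fdelta eqxx mulr1 big1 ?addr0 // => v
  ne.
by rewrite dvalZ dval_fdelta eq_sym (negbTE ne) mulr0.
Qed.

Lemma dval_mul f g w : dval (dual_mul f g) w = dval f w * dval g w.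
Proof. exact: (dval_dual_of (fun w => dval f w * dval g w)). Qed.

Lemma dval_one w : dval (dual_one Q) w = 1.
Proof.
rewrite /dual_one /dval sum_lfunE (bigD1 w) //= -/(dval _ _) dval_fdelta eqxx.
by rewrite big1 ?addr0 // => v ne;
  rewrite -/(dval _ _) dval_fdelta eq_sym (negbTE ne).
Qed.

Lemma X_E i w :
  X_ i w = (x_ (P i))^-1 * ((w == 1%g)%:R - (w == s_ i)%:R).
Proof. by rewrite !ffunE. Qed.

Lemma srefl_neq1 a : srefl a != 1%g.
Proof.
apply/eqP => e; have := srefl_root a; rewrite e => /= /eqP.
rewrite -addr_eq0 -mulr2n => /eqP h; have /eqP := root_neq0 a; apply.
by apply: (@lat_torsion_free _ _ 2%:Z).
Qed.

Lemma dval_X i f v :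
  dval (dual_act (X_ i) f) v =
  act v (x_ (P i))^-1 * (dval f v - dval f (v * s_ i)%g).
Proof.
rewrite dval_act (bigD1 1%g) //= (bigD1 (s_ i)) ?srefl_neq1 //= big1 ?addr0.
  rewrite !X_E !eqxx (negbTE (srefl_neq1 _)) eq_sym (negbTE (srefl_neq1 _)).
  by rewrite subr0 sub0r mulr1 mulrN1 rmorphN mulNr mulg1 mulrBr.
by move=> w /andP[/negbTE n1 /negbTE n2];
  rewrite X_E n1 n2 subrr mulr0 rmorph0 mul0r.
Qed.

Lemma qw_mul_X i z v :
  qw_mul (X_ i) z v =
  (x_ (P i))^-1 * (z v - act (s_ i) (z (s_ i * v)%g)).
Proof.
rewrite qw_mulE (bigD1 1%g) //= (bigD1 (s_ i)) ?srefl_neq1 //= big1 ?addr0.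
  rewrite !X_E !eqxx (negbTE (srefl_neq1 _)) eq_sym (negbTE (srefl_neq1 _)).
  by rewrite subr0 sub0r mulr1 mulrN1 mulNr loc_act1 invg1 mul1g sreflV mulrBr.
by move=> w /andP[/negbTE n1 /negbTE n2]; rewrite X_E n1 n2 subrr mulr0 mul0r.
Qed.

Lemma dual_X_seq f J y : f (qw_mul y (X_seq Q J)) = B_seq J f y.
Proof.
elim: J y => [|i J IH] y /=.
  congr (f _); apply/ffunP => u; rewrite qw_mulE (bigD1 u) //=.
  rewrite mulVg ffunE eqxx rmorph1 mulr1 big1 ?addr0 // => w ne.
  rewrite ffunE; case: eqP => [/eqP|]; last by rewrite rmorph0 mulr0.
  by rewrite -eq_mulVg1 => /eqP e; rewrite e eqxx in ne.
by rewrite dual_actE qw_mulA IH.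
Qed.

Lemma X_seqE f J : f (X_seq Q J) = dval (B_seq J f) 1%g.
Proof. by rewrite -[X_seq Q J]qw_mul1 dual_X_seq. Qed.

Lemma B_seq_cat J J' f : B_seq (J ++ J') f = B_seq J (B_seq J' f).
Proof. by rewrite /B_seq foldr_cat. Qed.

Lemma B_seq0 J : B_seq J (0 : QWdual Q) = 0.
Proof. by elim: J => //= i J ->; rewrite dual_act0. Qed.

Lemma B_seq_rcons J i f : B_seq (rcons J i) f = B_seq J (dual_act (X_ i) f).
Proof. by rewrite -cats1 B_seq_cat. Qed.

End TwistedAlgebra.

(** * The lattice of integral functionals and the pairing *)

Section DualLattice.
Variables (R : comNzRingType) (F : fgl R) (D : root_datum).
Variables (P : simple_system D) (Q : localized_fga F D).
Local Notation W := (weyl D).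
Local Notation S := (fga F (lat D)).
Local Notation idx := 'I_(srank P).
Local Notation act := (loc_act Q).
Local Notation x_ a := (xroot Q a).
Local Notation s_ i := (srefl (P i)).
Local Notation X_ := (Defs.X_ Q).
Local Notation X_seq := (Defs.X_seq Q).
Local Notation in_DF := (Defs.in_DF P (Q := Q)).
Local Notation in_DFdual := (Defs.in_DFdual P (Q := Q)).
Implicit Types (u v w : W) (a b : rootset D) (q : loc Q) (z : QW Q).
Implicit Types (f g h : QWdual Q) (i k : idx) (J : seq idx) (Xi : {set idx}).

Lemma in_DF_delta1 : in_DF (delta Q 1%g).
Proof. by have := in_DF_S P Q 1; rewrite rmorph1 scale1r. Qed.

Lemma in_DF_X_seq J : in_DF (X_seq J).
Proof.
elim: J => [|i J IH] /=; first exact: in_DF_delta1.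
by apply: in_DF_mul => //; apply: in_DF_X.
Qed.

Lemma qw_mul_scal q z v : qw_mul (q *: delta Q 1%g) z v = q * z v.
Proof.
rewrite qw_mulE (bigD1 1%g) //= !ffunE eqxx [q *: _]mulr1 loc_act1 invg1 mul1g.
by rewrite big1 ?addr0 // => w nw;
  rewrite !ffunE (negbTE nw) [q *: _]mulr0 mul0r.
Qed.

Lemma deltaM u v : delta Q (u * v)%g = qw_mul (delta Q u) (delta Q v).
Proof.
apply/ffunP => w; rewrite qw_mul_delta !ffunE rmorph_nat.
by rewrite -(inj_eq (mulgI u^-1%g)) mulKg.
Qed.

Lemma in_DF_delta J : in_DF (delta Q (sword J)).
Proof.
elim: J => [|i J IH]; first by rewrite sword_nil; apply: in_DF_delta1.
rewrite sword_cons deltaM; apply: in_DF_mul => //.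
(* This is [delta_(s_i) = 1 - x_(alpha_i) X_i]. *)
suff -> : delta Q (s_ i) = delta Q 1%g +
    qw_mul (loc_in Q (- fga_var F (val (P i))) *: delta Q 1%g) (X_ i).
  apply: in_DF_add; first exact: in_DF_delta1.
  by apply: in_DF_mul; [apply: in_DF_S | apply: in_DF_X].
apply/ffunP => v; rewrite [RHS]ffunE qw_mul_scal X_E rmorphN -/(xroot _ _)
  !ffunE.
by rewrite mulNr mulVKr ?unit_xroot // opprB addrCA subrr addr0.
Qed.

Lemma in_DFdual_act z f : in_DF z -> in_DFdual f -> in_DFdual (dual_act z f).
Proof.
by move=> hz hf z' hz'; rewrite dual_actE; apply: hf; apply: in_DF_mul.
Qed.

Lemma in_DFdual_B J f : in_DFdual f -> in_DFdual (B_seq J f).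
Proof.
move=> hf; elim: J => //= i J IH.
by apply: in_DFdual_act => //; apply: in_DF_X.
Qed.

Lemma in_DFdual_comb (J : finType) (A : pred J) (c : J -> S)
    (E : J -> QWdual Q) : (forall j, A j -> in_DFdual (E j)) ->
  in_DFdual (\sum_(j | A j) loc_in Q (c j) *: E j).
Proof.
move=> hE z hz; rewrite dual_sum.
apply: (@integral_sum _ _ _ _ _ A) => j hj.
by rewrite dualZ; apply: integralM; [exists (c j) | apply: hE].
Qed.

(* the other action of [W] on [Q_W^*], through left multiplication on [Q_W],
   which commutes with [dual_act] *)
Definition ltrans w f : QWdual Q :=
  dual_of (fun v => act w (dval f (w^-1 * v)%g)).

Lemma dval_ltrans w f v : dval (ltrans w f) v = act w (dval f (w^-1 * v)%g).
Proof. exact: dval_dual_of. Qed.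

Lemma ltransE w f z : ltrans w f z = act w (f (qw_mul (delta Q w^-1%g) z)).
Proof.
rewrite !dual_sumE rmorph_sum (reindex_inj (mulgI w)); apply: eq_bigr => v _.
by rewrite dval_ltrans mulKg qw_mul_delta invgK rmorphM loc_actKV.
Qed.

Lemma dual_X_one i : dual_act (X_ i) (dual_one Q) = 0.
Proof. by apply: dvalP => v; rewrite dval_X !dval_one subrr mulr0 dval0. Qed.

(** The form [<f, g>]: the constant value of [A_Pi(f g)], evaluated at [e]. *)
Definition pair0 f g : loc Q :=
  \sum_w act w (xprod Q [set: idx] finset.set0)^-1 * dval f w * dval g w.

Lemma pair0C f g : pair0 f g = pair0 g f.
Proof. by apply: eq_bigr => w _; rewrite mulrAC. Qed.

Lemma pair0_suml (J : finType) (A : pred J) (c : J -> loc Q) (E : J -> QWdual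
  Q) g :
  pair0 (\sum_(j | A j) c j *: E j) g = \sum_(j | A j) c j * pair0 (E j) g.
Proof.
under [RHS]eq_bigr => j _ do rewrite mulr_sumr.
rewrite exchange_big /=; apply: eq_bigr => w _.
rewrite dval_sum mulr_sumr mulr_suml; apply: eq_bigr => j _.
by rewrite dvalZ !mulrA; congr (_ * _ * _); rewrite mulrC.
Qed.

Lemma parabolic0 : parabolic (finset.set0 : {set idx}) = [set 1%g].
Proof. by rewrite /parabolic imset0 gen0. Qed.

Lemma neg_parabolic0 a : neg_parabolic (finset.set0 : {set idx}) a = false.
Proof. by rewrite neg_parabolicE parabolic0 inE (negbTE (srefl_neq1 _)) andbF.
  Qed.

Lemma xprod0E Xi :
  xprod Q Xi finset.set0 = \prod_(a | neg_parabolic Xi a) x_ a.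
Proof. by apply: eq_bigl => a; rewrite neg_parabolic0 andbT. Qed.

Lemma unit_xprod Xi Xi' : xprod Q Xi Xi' \is a GRing.unit.
Proof. by apply: rpred_prod => a _; apply: unit_xroot. Qed.

Lemma act_prod_xroot w (A : pred (rootset D)) :
  act w (\prod_(a | A a) x_ a) = \prod_(a | A (ract w^-1%g a)) x_ a.
Proof.
rewrite rmorph_prod [RHS](reindex_inj (@ract_inj _ w)) /=.
by apply: eq_big => a; rewrite ?ractK // => _; rewrite act_xroot.
Qed.

(** The factor of [x_Xi] at [- P k] is swapped with the extra factor at [P k], while [s_k] permutes
    the remaining negative roots of [Sigma_Xi]. *)
Lemma xprod_srefl Xi k : k \in Xi ->
  let c := xprod Q Xi finset.set0 * x_ (P k) in act (s_ k) c = c.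
Proof.
move=> kXi; rewrite /= xprod0E.
have sXi := srefl_parabolic kXi.
have nk : neg_parabolic Xi (ropp (P k)).
  by rewrite neg_parabolicE negr_opp simple_pos srefl_opp.
rewrite (bigD1 (ropp (P k))) //= !rmorphM act_prod_xroot sreflV !act_xroot.
rewrite ract_opp -/(ropp (P k)) roppK mulrAC [RHS]mulrAC [X in X * _]mulrC.
congr (_ * _); apply: eq_bigl => a; rewrite !neg_parabolicE.
have [->|ne] := eqVneq a (P k).
  by rewrite -/(ropp (P k)) eqxx andbF simple_pos.
have [->|ne'] := eqVneq a (ropp (P k)).
  by rewrite ract_opp -/(ropp (P k)) roppK simple_pos andbF.
rewrite srefl_ract_parabolic // negr_srefl_ne // andbT.
suff -> : ract (s_ k) a != ropp (P k) by rewrite andbT.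
apply: contraNneq ne => e; apply/eqP/(@ract_inj _ (s_ k)).
exact: e.
Qed.

End DualLattice.

(** Each [w] in [G] is uniquely [x y] with [y] in [H] and [x] the representative in [X] of the coset
    [w H]. *)
Lemma sum_transversal (gT : finGroupType) (V : zmodType) (H G : {group gT})
    (X : {set gT}) (E : gT -> V) : H \subset G ->
  is_transversal X (lcosets H G) G ->
  \sum_(x in X) \sum_(y in H) E (x * y)%g = \sum_(w in G) E w.
Proof.
move=> sHG trX; pose r w := transversal_repr 1%g X (w *: H)%g.
have cosG w : w \in G -> (w *: H)%g \in lcosets H G.
  by move=> wG; apply/lcosetsP; exists w.
have XI w : w \in G -> X :&: (w *: H)%g = [set r w].
  by move=> wG; apply: (setI_transversal_pblock trX); apply: cosG.
have XG := subsetP (transversal_sub trX).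
rewrite pair_big /= [RHS](reindex_onto (fun p : gT * gT => (p.1 * p.2)%g)
  (fun w => (r w, ((r w)^-1 * w)%g))) /=; last by move=> w _; rewrite mulKVg.
apply: eq_bigl => -[x y] /=; apply/andP/andP => [[xX yH]|[xyG /eqP[e1 e2]]].
  have xyG : (x * y)%g \in G by apply: groupM;
    [apply: XG | apply: (subsetP sHG)].
  have : x \in X :&: (x * y *: H)%g.
    by rewrite inE xX mem_lcoset invMg mulgKV groupV.
  by rewrite XI // => /set1P <-; rewrite mulKg eqxx.
have : r (x * y)%g \in X :&: (x * y *: H)%g by rewrite XI // set11.
rewrite e1 inE mem_lcoset invMg mulgKV groupV => /andP[-> yH].
by split.
Qed.

(** * Push-pull operators and the projection formula *)

Section PushPull.
Variables (R : comNzRingType) (F : fgl R) (D : root_datum).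
Variables (P : simple_system D) (Q : localized_fga F D).
Local Notation W := (weyl D).
Local Notation idx := 'I_(srank P).
Local Notation act := (loc_act Q).
Local Notation x_ a := (xroot Q a).
Local Notation s_ i := (srefl (P i)).
Local Notation X_ := (Defs.X_ Q).
Local Notation X_seq := (Defs.X_seq Q).
Implicit Types (u v w : W) (a b : rootset D) (q : loc Q) (z : QW Q).
Implicit Types (f g h : QWdual Q) (i k : idx) (J : seq idx) (Xi : {set idx}).
Implicit Types (X : {set W}).

Lemma dval_A Xi Xi' X f v : dval (A_ Xi Xi' X f) v =
  \sum_(w in X) act (v * w)%g (xprod Q Xi Xi')^-1 * dval f (v * w)%g.
Proof.
have dE w : (\sum_(u in X) delta Q u) w = (w \in X)%:R.
  rewrite sum_ffunE; case: (boolP (w \in X)) => wX.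
    rewrite (bigD1 w) //= ffunE eqxx big1 ?addr0 // => u /andP[_ nu].
    by rewrite ffunE eq_sym (negbTE nu).
  rewrite big1 // => u uX; rewrite ffunE; case: eqP => // e.
  by rewrite e uX in wX.
rewrite dval_act [RHS]big_mkcond; apply: eq_bigr => w _.
rewrite /Y_; move: (\sum_(u in X) _) dE => d dE.
rewrite qw_mulE (bigD1 w) //= big1 ?addr0 => [|u nu]; last first.
  rewrite !ffunE -eq_mulVg1 (negbTE nu) [X in act _ X]mulr0.
  by rewrite rmorph0 mulr0.
rewrite !ffunE mulVg eqxx [X in act w X]mulr1 dE.
by case: ifP; rewrite ?mul1r ?loc_actM // mul0r rmorph0 mul0r.
Qed.

Lemma dval_A0 Xi f v : dval (A0_ Xi f) v =
  \sum_(w in parabolic Xi)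
    act (v * w)%g (xprod Q Xi finset.set0)^-1 * dval f (v * w)%g.
Proof. exact: dval_A. Qed.

Lemma act_xprodV_srefl Xi k w : k \in Xi ->
  act (w * s_ k)%g ((xprod Q Xi finset.set0)^-1 * (x_ (P k))^-1) =
  act w ((xprod Q Xi finset.set0)^-1 * (x_ (P k))^-1).
Proof.
move=> kXi; rewrite loc_actM -invrM ?unit_xroot ?unit_xprod // mulrC.
rewrite rmorphV ?unitrM ?unit_xroot ?unit_xprod //.
by rewrite xprod_srefl.
Qed.

(** The weights [w(1 / (x_Pi x_(alpha_k)))] are unchanged under replacing [w] by [w s_k], so
    reindexing moves [s_k] from [g] to [f]. *)
Lemma pair0_X k f g :
  pair0 P f (dual_act (X_ k) g) = pair0 P (dual_act (X_ k) f) g.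
Proof.
pose e w := act w ((xprod Q [set: idx] finset.set0)^-1 * (x_ (P k))^-1).
have ek w : e (w * s_ k)%g = e w by apply: act_xprodV_srefl; rewrite inE.
have E f' g' : pair0 P f' (dual_act (X_ k) g') =
    \sum_w e w * dval f' w * dval g' w - \sum_w e w * dval f' w * dval g' (w * s_ k)%g.
  rewrite -sumrB; apply: eq_bigr => w _; rewrite dval_X -mulrBr /e rmorphM.
  by rewrite -!mulrA; congr (_ * _); rewrite mulrCA.
rewrite [RHS]pair0C !E; congr (_ - _).
  by apply: eq_bigr => w _; rewrite mulrAC.
rewrite (reindex_inj (mulIg (s_ k))); apply: eq_bigr => w _.
by rewrite ek -mulgA srefl2 mulg1 mulrAC.
Qed.

Lemma pair0_B J f g : pair0 P f (B_seq (rev J) g) = pair0 P (B_seq J f) g.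
Proof.
elim: J g => [|i J IH] g //=; rewrite rev_cons B_seq_rcons IH.
exact: pair0_X.
Qed.

Lemma dval_xPi_fe w : dval (xPi_fe P Q) w =
  xprod Q [set: idx] finset.set0 * (w == 1%g)%:R.
Proof. by rewrite dvalZ dval_fdelta. Qed.

Lemma pair0_xPi_fe f : pair0 P f (xPi_fe P Q) = dval f 1%g.
Proof.
rewrite /pair0 (bigD1 1%g) //= big1 => [|w nw]; last first.
  by rewrite dval_xPi_fe (negbTE nw) !mulr0.
rewrite dval_xPi_fe eqxx mulr1 addr0 loc_act1 mulrAC mulVr ?mul1r //.
exact: unit_xprod.
Qed.

(* Adjointness of the [B_i] turns [B_(rev J)] into right multiplication by
   [X_J], which [x_Pi f_e] then evaluates at [delta_e]. *)
Lemma pair0_B_xPi_fe f J : pair0 P f (B_seq (rev J) (xPi_fe P Q)) = f (X_seq J).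
Proof. by rewrite pair0_B pair0_xPi_fe X_seqE. Qed.

Lemma xprod_factor Xi : xprod Q [set: idx] finset.set0 =
  xprod Q [set: idx] Xi * xprod Q Xi finset.set0.
Proof.
rewrite !xprod0E (bigID (neg_parabolic Xi)) /= mulrC; congr (_ * _).
apply: eq_bigl => a; rewrite !neg_parabolicE.
case: (negr P a) => //=; apply: andb_idl.
exact/subsetP/parabolicS/subsetT.
Qed.

Lemma dual_inv_dval Xi f : dual_inv (parabolic Xi) f ->
  forall v w, w \in parabolic Xi -> dval f (v * w)%g = dval f v.
Proof. by move=> hf v w /hf e; rewrite -{2}e dval_act_delta. Qed.

Lemma dval_dual_inv Xi f :
  (forall v w, w \in parabolic Xi -> dval f (v * w)%g = dval f v) ->
  dual_inv (parabolic Xi) f.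
Proof. by move=> hf w wXi; apply: dvalP => v; rewrite dval_act_delta hf. Qed.

Lemma A0_inv Xi f : dual_inv (parabolic Xi) (A0_ Xi f).
Proof.
apply: dval_dual_inv => v w wXi; rewrite !dval_A0.
rewrite [RHS](reindex_inj (mulgI w)); apply: eq_big => y.
  by rewrite groupMl.
by rewrite mulgA.
Qed.

Lemma A_mul_sumr Xi X f (J : finType) (A : pred J) (c : J -> loc Q)
    (E : J -> QWdual Q) :
  A_ [set: idx] Xi X (dual_mul f (\sum_(j | A j) c j *: E j)) =
  \sum_(j | A j) c j *: A_ [set: idx] Xi X (dual_mul f (E j)).
Proof.
apply: dvalP => v; rewrite dval_A dval_sum.
under [RHS]eq_bigr => j _ do rewrite dvalZ dval_A mulr_sumr.
rewrite [RHS]exchange_big; apply: eq_bigr => w _.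
rewrite dval_mul dval_sum !mulr_sumr; apply: eq_bigr => j _.
by rewrite dvalZ dval_mul; ring.
Qed.

Section Generated.
Hypothesis parT : parabolic [set: idx] = [set: W].

Lemma neg_parabolicT a : neg_parabolic [set: idx] a = negr P a.
Proof. by rewrite neg_parabolicE parT inE andbT. Qed.

Lemma xprodTE Xi : xprod Q [set: idx] Xi =
  \prod_(a | negr P a && (srefl a \notin parabolic Xi)) x_ a.
Proof.
apply: eq_bigl => a; rewrite neg_parabolicT neg_parabolicE.
by case: (negr P a).
Qed.

(** [W_Xi] permutes the negative roots outside [Sigma_Xi]. *)
Lemma act_xprodT Xi w : w \in parabolic Xi ->
  act w (xprod Q [set: idx] Xi) = xprod Q [set: idx] Xi.
Proof.
move=> wXi; rewrite xprodTE act_prod_xroot; apply: eq_bigl => a.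
rewrite srefl_ract_parabolic ?groupV // andbC [RHS]andbC.
by case: (boolP (_ \in _)) => //= aXi;
  rewrite (negr_ract_parabolic _ aXi) ?groupV.
Qed.

(* The projection formula and [A_Pi = A_(Pi/Xi) A_Xi]. *)
Lemma A_mul_A0 Xi X f g : coset_reps [set: idx] Xi X ->
  dual_inv (parabolic Xi) f ->
  A_ [set: idx] Xi X (dual_mul f (A0_ Xi g)) = pair0 P f g *: dual_one Q.
Proof.
move=> hX /dual_inv_dval hf; apply: dvalP => v; rewrite dvalZ dval_one mulr1.
pose G w := act w (xprod Q [set: idx] finset.set0)^-1 * dval f w * dval g w.
have sub : parabolic Xi \subset parabolic [set: idx] by rewrite parT subsetT.
transitivity (\sum_(x in X) \sum_(y in parabolic Xi) G (v * (x * y))%g).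
  rewrite dval_A; apply: eq_bigr => x _; rewrite dval_mul dval_A0 !mulr_sumr.
  apply: eq_bigr => y yXi; rewrite /G !mulgA (hf (v * x)%g y yXi) (xprod_factor
    Xi).
  have e : act (v * x * y)%g (xprod Q [set: idx] Xi)^-1 =
      act (v * x)%g (xprod Q [set: idx] Xi)^-1.
    by rewrite loc_actM [act y _]rmorphV ?unit_xprod // act_xprodT.
  by rewrite invrM ?unit_xprod // rmorphM e; ring.
rewrite (sum_transversal (fun w => G (v * w)%g) sub hX) /pair0.
rewrite [RHS](reindex_inj (mulgI v)); apply: eq_bigl => w.
by have : w \in parabolic [set: idx] by rewrite parT inE.
Qed.

End Generated.

End PushPull.

(** * Triangularity and dual bases *)

Section Triangularity.
Variables (R : comNzRingType) (F : fgl R) (D : root_datum).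
Variables (P : simple_system D) (Q : localized_fga F D).
Local Notation W := (weyl D).
Local Notation idx := 'I_(srank P).
Local Notation act := (loc_act Q).
Local Notation x_ a := (xroot Q a).
Local Notation s_ i := (srefl (P i)).
Local Notation X_ := (Defs.X_ Q).
Local Notation X_seq := (Defs.X_seq Q).
Local Notation in_DFdual := (Defs.in_DFdual P (Q := Q)).
Implicit Types (u v w : W) (a b : rootset D) (q : loc Q) (z : QW Q).
Implicit Types (f g h : QWdual Q) (i k : idx) (J : seq idx) (Xi : {set idx}).
Variables (I : W -> seq idx) (hI : forall w, reduced_seq w (I w)).

(** Only products of subwords of [J] occur in [X_J], and a proper subword is too short. In the
    induction both [v] and [s_i v] meet the assumptions for the tail. *)
Lemma X_seq_eq0 J v :
  (size J <= len P v)%N -> v != sword J -> X_seq J v = 0.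
Proof.
elim: J v => [|i J IH] v /= lv nv.
  by rewrite ffunE; move: nv; rewrite sword_nil => /negbTE ->.
rewrite qw_mul_X IH ?IH ?rmorph0 ?subrr ?mulr0 //.
- rewrite -ltnS; apply: leq_trans lv _; rewrite -{1}[v](mulKVg (s_ i)) sreflV.
  apply: leq_trans (lenM hI _ _) _; rewrite -add1n leq_add2r.
  by apply: (@len_min _ _ [:: i]); rewrite sword_cons sword_nil mulg1.
- by apply: contraNneq nv => e; rewrite sword_cons -e mulgA srefl2 mul1g.
- exact: ltnW.
- by apply: contraTneq lv => ->; rewrite -ltnNge ltnS len_sword.
Qed.

Definition xinv w : loc Q := \prod_(a in invs P w) x_ a.

Lemma unit_xinv w : xinv w \is a GRing.unit.
Proof. exact: unit_prod_xroot. Qed.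

(** The coefficient of [delta_w] in [X_(I_w)]; this closed form shows it to be independent of the
    reduced word. *)
Definition lead w : loc Q := (-1) ^+ len P w * (xinv w)^-1.

Lemma unit_lead w : lead w \is a GRing.unit.
Proof. by rewrite unitrM unitrX ?unitrN1 // unitrV unit_xinv. Qed.

(** At [s_i w] only the second term of [X_i] contributes: it applies [s_i] and divides by
    [- x_(alpha_i)], which matches [invs_cons]. *)
Lemma X_seq_reduced J : size J = len P (sword J) ->
  X_seq J (sword J) = (-1) ^+ size J * (xinv (sword J))^-1.
Proof.
elim: J => [|i J IH] red /=.
  rewrite sword_nil ffunE eqxx mul1r /xinv big1 ?invr1 // => a.
  by rewrite inE invg1 ract1 andNb.
have redJ := reduced_tail hI red; have [e notin] := invs_cons hI red.
have -> : xinv (sword (i :: J)) = x_ (P i) * act (s_ i) (xinv (sword J)).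
  rewrite /xinv e big_setU1 //=; congr (_ * _).
  rewrite big_imset /=; last by move=> a b _ _; apply: ract_inj.
  by rewrite rmorph_prod; apply: eq_bigr => a _; rewrite act_xroot.
rewrite qw_mul_X sword_cons mulgA srefl2 mul1g X_seq_eq0.
- rewrite sub0r IH // rmorphM rmorphXn rmorphN1 invrM ?unit_xroot ?act_unit
  ?unit_xinv //.
  by rewrite rmorphV ?unit_xinv // exprS; ring.
- by rewrite -sword_cons -red leqnSn.
apply/eqP => e'; have := srefl_neq1 (P i); rewrite -(inj_eq (mulIg (sword J))).
by rewrite e' mul1g eqxx.
Qed.

Lemma X_seq_lead w : X_seq (I w) w = lead w.
Proof.
have := @X_seq_reduced (I w); rewrite (sword_reduced hI) (size_reduced hI).
exact.
Qed.

Lemma eval_lead f w : (forall v, (len P v < len P w)%N -> dval f v = 0) ->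
  f (X_seq (I w)) = lead w * dval f w.
Proof.
move=> f0; rewrite dual_sumE (bigD1 w) //= X_seq_lead big1 ?addr0 // => v nv.
have [lv|lv] := ltnP (len P v) (len P w); first by rewrite f0 // mulr0.
by rewrite X_seq_eq0 ?mul0r // ?(sword_reduced hI) // (size_reduced hI).
Qed.

Lemma dual_eq0 f : (forall w, f (X_seq (I w)) = 0) -> f = 0.
Proof.
move=> f0; apply: dvalP => w; rewrite dval0.
have [n] := ubnP (len P w); elim: n w => // n IH w; rewrite ltnS => lw.
apply: (mulrI (unit_lead w)); rewrite mulr0 -eval_lead // => v lv.
by apply: IH; apply: leq_trans lv lw.
Qed.

Section DualBasis.
Variables (Xs : W -> QWdual Q) (hXs : dual_family I Xs).

Lemma dual_expand f : f = \sum_w f (X_seq (I w)) *: Xs w.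
Proof.
apply/eqP; rewrite -subr_eq0; apply/eqP/dual_eq0 => w.
rewrite add_lfunE opp_lfunE dual_sum (bigD1 w) //= dualZ hXs.2 eqxx mulr1.
rewrite big1 ?addr0 ?subrr // => v nv.
by rewrite dualZ hXs.2 (negbTE nv) mulr0.
Qed.

(** The values at the [X_(I_w)] are the coordinates of [f] in the dual family, whose members are
    integral on [D_F]. *)
Lemma in_DFdualP f :
  in_DFdual f <-> forall w, integral (f (X_seq (I w))).
Proof.
split=> [hf w|hf z hz]; first by apply: hf; apply: in_DF_X_seq.
rewrite (dual_expand f) dual_sum.
apply: (@integral_sum _ _ _ _ _ predT) => w _; rewrite dualZ.
by apply: integralM => //; apply: hXs.1.
Qed.

Lemma in_DFdual_one : in_DFdual (dual_one Q).
Proof.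
apply/in_DFdualP => w; rewrite X_seqE; case/lastP: (I w) => [|J k] /=.
  by rewrite dval_one; apply: integral1.
by rewrite B_seq_rcons dual_X_one B_seq0 dval0; apply: integral0.
Qed.

(** [D_F] contains every [delta_w], and [W] preserves [S]. *)
Lemma in_DFdual_ltrans w f : in_DFdual f -> in_DFdual (ltrans w f).
Proof.
move=> hf z hz; rewrite ltransE; apply: integral_act; apply: hf.
apply: in_DF_mul => //; rewrite -(sword_reduced hI w^-1%g).
exact: in_DF_delta.
Qed.

(** Inverse of a triangular matrix: induction on the length of [w], with [eval_lead] isolating the
    value at [w]. *)
Lemma dual_lead u w :
  (len P w <= len P u)%N -> dval (Xs u) w = (w == u)%:R * (lead u)^-1.
Proof.
have [n] := ubnP (len P w); elim: n w => // n IH w; rewrite ltnS => lw lwu.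
apply: (mulrI (unit_lead w)); rewrite -eval_lead ?hXs.2 => [|v lv].
  rewrite eq_sym; case: eqP => [->|_]; last by rewrite mul0r mulr0.
  by rewrite mul1r divrr // unit_lead.
rewrite IH.
- by case: eqP lv => [->|]; rewrite ?mul0r // ltnNge lwu.
- exact: leq_trans lv lw.
- exact: leq_trans (ltnW lv) lwu.
Qed.

End DualBasis.

(** Counterpart of [X_seq_eq0]: the support starts at [e], and each [B_i] enlarges it by right
    multiplication by [s_i], so the word is read in reverse. *)
Lemma B_xPi_fe_eq0 J v : (size J <= len P v)%N -> v != sword (rev J) ->
  dval (B_seq J (xPi_fe P Q)) v = 0.
Proof.
elim: J v => [|i J IH] v /= lv nv.
  by rewrite dval_xPi_fe; move: nv; rewrite sword_nil => /negbTE ->;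
    rewrite mulr0.
move: nv; rewrite rev_cons sword_rcons => nv.
rewrite dval_X IH ?IH ?subrr ?mulr0 //.
- rewrite -ltnS; apply: leq_trans lv _; rewrite -{1}[v](mulgK (s_ i)) sreflV.
  apply: leq_trans (lenM hI _ _) _; rewrite -addn1 leq_add2l.
  by apply: (@len_min _ _ [:: i]); rewrite sword_cons sword_nil mulg1.
- by apply: contraNneq nv => <-; rewrite -mulgA srefl2 mulg1.
- exact: ltnW.
- by apply: contraTneq lv => ->; rewrite -ltnNge ltnS -size_rev len_sword.
Qed.

End Triangularity.

(** * Invariants under the parabolic subgroup *)

Section Parabolic.
Variables (R : comNzRingType) (F : fgl R) (D : root_datum).
Variables (P : simple_system D) (Q : localized_fga F D).
Local Notation W := (weyl D).
Local Notation idx := 'I_(srank P).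
Local Notation act := (loc_act Q).
Local Notation s_ i := (srefl (P i)).
Local Notation X_ := (Defs.X_ Q).
Local Notation X_seq := (Defs.X_seq Q).
Local Notation in_DFdual := (Defs.in_DFdual P (Q := Q)).
Implicit Types (u v w y : W) (a b : rootset D) (q : loc Q) (z : QW Q).
Implicit Types (f g h : QWdual Q) (i k : idx) (J : seq idx).
Variables (I : W -> seq idx) (hI : forall w, reduced_seq w (I w)).
Variables (Xs : W -> QWdual Q) (hXs : dual_family I Xs).
Variables (Xi : {set idx}) (hXi : compatible Xi I).
Local Notation H := (parabolic Xi).
Local Notation xT := (xprod Q [set: idx] Xi).

Definition eta w : QWdual Q := A0_ Xi (B_seq (rev (I w)) (xPi_fe P Q)).

Lemma len_min_mul u v : u \in min_reps Xi -> v \in H ->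
  len P (u * v)%g = (len P u + len P v)%N.
Proof.
by move=> hu hv; rewrite -!(size_reduced hI) (hXi hu hv) size_cat.
Qed.

(** Additivity of lengths for [u v], and for [u] written as [(u v) v^-1], forces [v] to have length
    0. *)
Lemma min_reps_uniq u v : u \in min_reps Xi -> (u * v)%g \in min_reps Xi ->
  v \in H -> v = 1%g.
Proof.
move=> hu huv hv; apply/eqP; rewrite -(len_eq0 hI).
have := len_min_mul huv (groupVr hv); rewrite mulgK (len_min_mul hu hv).
by rewrite (lenV hI); lia.
Qed.

(** By compatibility [I_w] ends with [I_v] for some [v] in [W_Xi] other than 1. Its last letter is a
    descent of [v], and descents of elements of [W_Xi] lie in [Xi]. *)
Lemma reduced_last w :
  w \notin min_reps Xi -> exists2 k, k \in Xi & exists J, I w = rcons J k.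
Proof.
move=> hw; have [u [v [hu hv e]]] := min_reps_factor hI Xi w.
case/lastP eJ: (I v) => [|J k].
  have v1 : v = 1%g by rewrite -(sword_reduced hI v) eJ sword_nil.
  by rewrite e v1 mulg1 hu in hw.
exists k; last by exists (I u ++ J); rewrite e hXi // eJ rcons_cat.
apply: neg_ract_parabolic_in hv _.
rewrite -[negr _ _]negbK -(len_ltM_srefl hI) -leqNgt.
have -> : (v * s_ k)%g = sword J.
  by rewrite -(sword_reduced hI v) eJ sword_rcons -mulgA srefl2 mulg1.
apply: leq_trans (len_sword _) _.
by rewrite -(size_reduced hI v) eJ size_rcons.
Qed.

(** The word [I_w] ends with a letter of [Xi], and the corresponding [X_k] kills invariants. *)
Lemma inv_eval_eq0 g w :
  dual_inv H g -> w \notin min_reps Xi -> g (X_seq (I w)) = 0.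
Proof.
move=> /dual_inv_dval hg /reduced_last[k kXi [J ->]].
rewrite X_seqE B_seq_rcons.
suff -> : dual_act (X_ k) g = 0 by rewrite B_seq0 dval0.
apply: dvalP => v; rewrite dval_X hg ?srefl_parabolic //.
by rewrite subrr mulr0 dval0.
Qed.

Definition coset_ind u : QWdual Q := dual_of (fun w => ((u^-1 * w)%g \in H)%:R).

Lemma coset_ind_inv u : dual_inv H (coset_ind u).
Proof.
by apply: dval_dual_inv => v w wH; rewrite !dval_dual_of mulgA groupMr.
Qed.

(** No element shorter than [u] lies in [u W_Xi], so only the leading term is seen. *)
Lemma coset_ind_eval u w : u \in min_reps Xi -> w \in min_reps Xi ->
  (len P w <= len P u)%N ->
  coset_ind u (X_seq (I w)) = (w == u)%:R * lead P Q u.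
Proof.
move=> hu hw lwu; rewrite (eval_lead hI) => [|v lv].
  rewrite dval_dual_of mulrC; case: (w =P u) => [->|ne].
    by rewrite mulVg group1.
  case: (boolP (_ \in H)) => [h|]; last by rewrite !mul0r.
  case: ne; have := @min_reps_uniq u (u^-1 * w)%g hu.
  by rewrite mulKVg => /(_ hw h) /eqP; rewrite -eq_mulVg1 => /eqP.
rewrite dval_dual_of; case: (boolP (_ \in H)) => // h.
have := len_min_mul hu h; rewrite mulKVg; lia.
Qed.

(* The indicator of [u W_Xi] is invariant and, by triangularity, a combination
   of [X_(I_u)^*] and of the [X_(I_w)^*] with [w] in [W^Xi] longer than [u]. *)
Lemma dual_min_inv u : u \in min_reps Xi -> dual_inv H (Xs u).
Proof.
pose N := (\max_(w : W) len P w)%N.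
have lN w : (len P w <= N)%N by apply: (leq_bigmax w).
(* Descending induction on the length of [u]. *)
have [n] := ubnP (N - len P u)%N; elim: n u => // n IH u; rewrite ltnS => ln hu.
have e : coset_ind u = lead P Q u *: Xs u +
    \sum_(w | (w \in min_reps Xi) && (len P u < len P w)%N)
      coset_ind u (X_seq (I w)) *: Xs w.
  rewrite {1}(dual_expand hI hXs (coset_ind u)) (bigD1 u) //=.
  rewrite coset_ind_eval // eqxx mul1r; congr (_ + _).
  rewrite big_mkcond [RHS]big_mkcond; apply: eq_bigr => w _.
  case: (boolP (w \in min_reps Xi)) => hw /=; last first.
    by rewrite inv_eval_eq0 ?scale0r ?if_same //; apply: coset_ind_inv.
  case: ltnP => lw; first by case: eqP lw => // ->; rewrite ltnn.
  case: (w =P u) => //= /eqP ne.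
  by rewrite coset_ind_eval // (negbTE ne) mul0r scale0r.
apply: dval_dual_inv => v y yH; apply: (mulrI (unit_lead P Q u)).
have hc v' : lead P Q u * dval (Xs u) v' = dval (coset_ind u) v' -
   \sum_(w | (w \in min_reps Xi) && (len P u < len P w)%N)
      coset_ind u (X_seq (I w)) * dval (Xs w) v'.
  rewrite {1}e /dval dualD dualZ dual_sum.
  by under eq_bigr => w _ do rewrite dualZ; rewrite addrK.
rewrite !hc (dual_inv_dval (coset_ind_inv u)) //; congr (_ - _).
apply: eq_bigr => w /andP[hw lw]; congr (_ * _).
by apply: (dual_inv_dval (IH w _ hw)) => //; have := lN w; lia.
Qed.

Lemma inv_expand f : dual_inv H f ->
  f = \sum_(u in min_reps Xi) f (X_seq (I u)) *: Xs u.
Proof.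
move=> hf; rewrite {1}(dual_expand hI hXs f) [RHS]big_mkcond.
apply: eq_bigr => w _; case: ifP => // /negbT hw.
by rewrite inv_eval_eq0 // scale0r.
Qed.

(** Pairing with [X_(I_u)^*] gives 1, and only the term at [u] survives: the two factors vanish at
    the other elements of length at most, respectively at least, that of [u]. *)
Lemma dval_B_xPi_fe_lead u :
  dval (B_seq (rev (I u)) (xPi_fe P Q)) u =
  act u (xprod Q [set: idx] finset.set0) * lead P Q u.
Proof.
set g := B_seq _ _; have := pair0_B_xPi_fe (Xs u) (I u).
rewrite hXs.2 eqxx -/g /pair0 (bigD1 u) //= big1 => [|v nv].
  rewrite (dual_lead hI hXs) // eqxx mul1r addr0 => e.
  have U : act u (xprod Q [set: idx] finset.set0)^-1 * (lead P Q u)^-1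
      \is a GRing.unit.
    by rewrite unitrM unitrV unit_lead act_unit // unitrV unit_xprod.
  apply: (mulrI U); rewrite e rmorphV ?unit_xprod // mulrACA.
  by rewrite !mulVr ?mulr1 ?unit_lead ?act_unit ?unit_xprod.
have [lv|lv] := leqP (len P v) (len P u).
  by rewrite (dual_lead hI hXs) // (negbTE nv) mul0r mulr0 mul0r.
rewrite [dval g v](B_xPi_fe_eq0 Q hI) ?mulr0 ?revK ?(sword_reduced hI) //.
by rewrite size_rev (size_reduced hI) ltnW.
Qed.

(** In the sum over [w W_Xi] every element is at least as long as [u], so only [u] itself can
    contribute, and it does so only if [w = u]. *)
Lemma dval_eta u w : u \in min_reps Xi -> w \in min_reps Xi ->
  (len P u <= len P w)%N ->
  dval (eta u) w = (w == u)%:R * (act u xT * lead P Q u).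
Proof.
move=> hu hw luw; rewrite dval_A0.
have z y : y \in H -> (w * y)%g != u ->
    dval (B_seq (rev (I u)) (xPi_fe P Q)) (w * y)%g = 0.
  move=> yH ne; apply: (B_xPi_fe_eq0 Q hI); last by rewrite revK sword_reduced.
  by rewrite size_rev (size_reduced hI) len_min_mul //; lia.
case: (w =P u) => [->|ne]; last first.
  rewrite big1 ?mul0r // => y yH; rewrite z ?mulr0 //.
  apply/eqP => e; have y1 : y = 1%g by apply: (min_reps_uniq hw); rewrite ?e.
  by apply: ne; rewrite -e y1 mulg1.
rewrite (bigD1 1%g) ?group1 //= big1 ?addr0 => [|y /andP[yH ny]]; last first.
  rewrite (B_xPi_fe_eq0 Q hI) ?mulr0 // ?size_rev ?(size_reduced hI).
    by rewrite len_min_mul // leq_addr.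
  rewrite revK (sword_reduced hI); apply: contraNneq ny => e.
  by apply/eqP/(mulgI u); rewrite e mulg1.
rewrite mulg1 dval_B_xPi_fe_lead (xprod_factor _ Xi) mul1r rmorphM.
rewrite rmorphV ?unit_xprod // mulrA; congr (_ * _).
by rewrite mulrC mulrK ?act_unit ?unit_xprod.
Qed.

Lemma pair_eta X f w : coset_reps [set: idx] Xi X -> dual_inv H f ->
  A_ [set: idx] Xi X (dual_mul f (eta w)) = f (X_seq (I w)) *: dual_one Q.
Proof.
move=> hX hf; rewrite (A_mul_A0 (parabolicT hI) _ hX hf).
by rewrite pair0_B_xPi_fe.
Qed.

End Parabolic.

(** * Longest elements and integrality of leading values *)

Section Longest.
Variables (R : comNzRingType) (F : fgl R) (D : root_datum).
Variables (P : simple_system D) (Q : localized_fga F D).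
Local Notation W := (weyl D).
Local Notation idx := 'I_(srank P).
Local Notation act := (loc_act Q).
Local Notation x_ a := (xroot Q a).
Local Notation X_ := (Defs.X_ Q).
Local Notation X_seq := (Defs.X_seq Q).
Local Notation in_DFdual := (Defs.in_DFdual P (Q := Q)).
Implicit Types (u v w y : W) (a b : rootset D) (q : loc Q) (z : QW Q).
Implicit Types (f g h : QWdual Q) (i k : idx) (J : seq idx).
Variables (I : W -> seq idx) (hI : forall w, reduced_seq w (I w)).
Variables (Xs : W -> QWdual Q) (hXs : dual_family I Xs).
Variables (Xi : {set idx}) (hXi : compatible Xi I).
Local Notation H := (parabolic Xi).
Local Notation xT := (xprod Q [set: idx] Xi).
Local Notation eta := (eta Q I Xi).
Variables (w0 v0 : W) (hw0 : forall a, negr P (ract w0 a) = ~~ negr P a).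
Hypotheses (v0H : v0 \in H).
Hypotheses (hv0 : forall i, i \in Xi -> negr P (ract v0 (P i)) = true).
Hypotheses (v0_max : forall v, v \in H -> (len P v <= len P v0)%N).

Lemma negr_v0 a : srefl a \in H -> negr P (ract v0 a) = ~~ negr P a.
Proof.
move=> aH; rewrite (@negr_ract_span _ _ _ Xi _ true) // => i.
exact: coef_parabolic0.
Qed.

Lemma negr_min_reps u a :
  u \in min_reps Xi -> srefl a \in H -> negr P (ract u a) = negr P a.
Proof.
move=> /(min_repsP hI) hu aH; rewrite (@negr_ract_span _ _ _ Xi _ false) // =>
  i.
exact: coef_parabolic0.
Qed.

(* Both sides are products over the roots [u b], [b] negative and outside
   [Sigma_Xi], split according to the sign of [u b]. *)
Lemma act_xT_min u : u \in min_reps Xi ->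
  act u xT = xinv P Q u * act w0^-1%g (xinv P Q (w0 * u * v0)%g).
Proof.
move=> hu; rewrite (xprodTE _ (parabolicT hI)) /xinv !act_prod_xroot.
rewrite (bigID (negr P)) /= mulrC; congr (_ * _); apply: eq_bigl => a.
  rewrite inE; set b := ract u^-1%g a; have ea : a = ract u b by rewrite ractKV.
  case: (boolP (srefl b \in H)) => bH; last by rewrite andbT andbC.
  by rewrite andbF ea negr_min_reps //; case: (negr P b).
rewrite inE invgK !invMg !ractM ractK hw0 negbK.
set b := ract u^-1%g a; have ea : a = ract u b by rewrite ractKV.
case: (boolP (srefl b \in H)) => bH; last first.
  by rewrite (negr_ract_parabolic _ bH) ?groupV // andbT andbC.
rewrite andbF /= ea negr_min_reps // -{1}[b](ractKV v0) negr_v0.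
  by rewrite andNb.
by rewrite srefl_ract_parabolic ?groupV.
Qed.

(** By [act_xT_min] the two products of roots cancel against the denominators of the leading
    coefficients, leaving signs. *)
Lemma lead_w0 u : u \in min_reps Xi -> exists n,
  act w0^-1%g (lead P Q (w0 * u * v0)%g) * (act u xT * lead P Q u) = (-1) ^+ n.
Proof.
move=> hu; exists (len P u + len P (w0 * u * v0)%g)%N; rewrite act_xT_min //.
set t := (w0 * u * v0)%g; rewrite /lead rmorphM rmorphXn rmorphN1.
rewrite rmorphV ?unit_xinv //; set p := act _ (xinv P Q t); set r := xinv P Q u.
have Up : p \is a GRing.unit by rewrite act_unit ?unit_xinv.
have Ur : r \is a GRing.unit by rewrite unit_xinv.
set A := _ ^+ len P t; set B := _ ^+ len P u.
have -> : A / p * (r * p * (B / r)) = B * A * (p / p) * (r / r) by ring.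
by rewrite !divrr // !mulr1 exprD.
Qed.

Lemma len_w0 w : (len P (w0 * w)%g + len P w)%N = len P w0.
Proof.
have := len_longestM hI 1%g hw0; rewrite mulg1 (len1 P) addn0 => ->.
by rewrite (len_longestM hI w hw0).
Qed.

Lemma mul_w0_min u : u \in min_reps Xi -> (w0 * u * v0)%g \in min_reps Xi.
Proof.
move=> hu; apply/(min_repsP hI) => i iXi.
rewrite !ractM hw0 negr_min_reps ?hv0 // srefl_ract_parabolic //.
exact: srefl_parabolic.
Qed.

(** Both [u v0] and [w0] bound: [l(u) + l(v0) = l(u v0)] is at most [l(w0) = l(w0 v0) + l(v0)]. *)
Lemma len_min_reps_max u :
  u \in min_reps Xi -> (len P u <= len P (w0 * v0)%g)%N.
Proof.
move=> hu; have h1 : 1%g \in min_reps Xi.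
  by apply/(min_repsP hI) => i _; rewrite ract1 simple_pos.
have := len_w0 v0.
have := len_w0 (w0^-1 * (u * v0))%g; rewrite mulKVg (len_min_mul hI hXi) //.
lia.
Qed.

(* [x_(Pi/Xi)] times the indicator of [W_Xi]; up to sign it is the dual basis
   element of the longest element of [W^Xi], moved by the longest element. *)
Definition xind : QWdual Q := dual_of (fun w => (w \in H)%:R * xT).

Lemma in_DFdual_xind : in_DFdual xind.
Proof.
have h1 : 1%g \in min_reps Xi.
  by apply/(min_repsP hI) => i _; rewrite ract1 simple_pos.
have [n] := lead_w0 h1; have := mul_w0_min h1; rewrite mulg1.
set t := (w0 * v0)%g => ht; rewrite loc_act1.
have -> : lead P Q 1%g = 1.
  rewrite /lead (len1 P) /xinv big1 ?invr1 ?mulr1 // => a.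
  by rewrite inE invg1 ract1 andNb.
rewrite mulr1 => e.
(* The case [u = 1] of [lead_w0]: up to sign, [x_(Pi/Xi)] is the translated value of [X_(I_t)^*] at
   [t]. *)
have xE : act w0^-1%g (lead P Q t)^-1 = (-1) ^+ n * xT.
  have U : act w0^-1%g (lead P Q t) \is a GRing.unit.
    by rewrite act_unit ?unit_lead.
  apply: (mulrI U); rewrite rmorphV ?unit_lead // divrr // mulrCA e.
  by rewrite -expr2 sqrr_sign.
suff -> : xind = (-1) ^+ n *: ltrans w0^-1%g (Xs t).
  move=> z hz; rewrite dualZ; apply: integralM.
    by exists ((-1) ^+ n); rewrite rmorphXn rmorphN1.
  exact: (in_DFdual_ltrans hI _ (hXs.1 t)) hz.
apply: dvalP => w; rewrite dval_dual_of dvalZ dval_ltrans invgK.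
have [u [v [hu vH ew]]] := min_reps_factor hI Xi (w0 * w)%g.
rewrite ew (dual_inv_dval (dual_min_inv hI hXs hXi ht) _ vH).
(* As [t] is longest in [W^Xi], [dual_lead] covers all values on [W^Xi]. *)
rewrite (dual_lead hI hXs) ?len_min_reps_max // rmorphM rmorph_nat xE.
have -> : (w \in H) = (u == t).
  apply/idP/eqP => [wH|eu].
    have eu : u = (t * (v0^-1 * w * v^-1))%g.
      by rewrite /t !mulgA mulgK ew mulgK.
    rewrite eu in hu *; rewrite (min_reps_uniq hI hXi ht hu) ?mulg1 //.
    by rewrite !groupM ?groupV.
  have -> : w = (v0 * v)%g by apply: (mulgI w0); rewrite ew eu mulgA.
  by rewrite groupM.
by rewrite [RHS]mulrCA [X in _ = _ * X]mulrA -expr2 sqrr_sign mul1r.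
Qed.

Lemma integral_lead u g : u \in min_reps Xi -> in_DFdual g ->
    dual_inv H g ->
    (forall w, w \in min_reps Xi -> (len P u < len P w)%N -> dval g w = 0) ->
  exists s, dval g u = loc_in Q s * (act u xT * lead P Q u).
Proof.
move=> hu Lg ig g0; set t := (w0 * u * v0)%g.
have lt : (len P t + (len P u + len P v0))%N = len P w0.
  by rewrite -(len_w0 (u * v0)%g) mulgA (len_min_mul hI hXi).
have := in_DFdual_ltrans hI w0 Lg (in_DF_X_seq Q (I t)).
(* If [v] is shorter than [t], then [w0^-1 v] is longer than [u v0]; its [W_Xi] part is at most as
   long as [v0], so its part in [W^Xi] is longer than [u], where [g] vanishes. *)
rewrite (eval_lead hI) => [|v lv]; last first.
  rewrite dval_ltrans; have [w [y [hw yH e]]] := min_reps_factor hI Xi (w0^-1 *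
    v)%g.
  rewrite e (dual_inv_dval ig) // g0 ?rmorph0 //.
  have := len_w0 (w0^-1 * v)%g; rewrite mulKVg e (len_min_mul hI hXi) //.
  by have := v0_max yH; lia.
rewrite dval_ltrans /t -mulgA mulKg (dual_inv_dval ig) // =>
  /(integral_act w0^-1%g).
rewrite rmorphM loc_actK; set p := _ * _ => -[s ps].
(* The sign relating the leading coefficient at [t] to that of [eta_u] squares to 1. *)
have [n e] := lead_w0 hu; exists ((-1) ^+ n * s).
rewrite rmorphM -ps rmorphXn rmorphN1 -[LHS]mul1r.
by rewrite -[X in X * _ = _](sqrr_sign _ n) expr2 -{2}e /p [(w0 * (_ *
  _))%g]mulgA; ring.
Qed.

End Longest.

(** * Spanning, integrality of the pairing, and stability under [A_Xi] *)

Section Bases.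
Variables (R : comNzRingType) (F : fgl R) (D : root_datum).
Variables (P : simple_system D) (Q : localized_fga F D).
Local Notation W := (weyl D).
Local Notation S := (fga F (lat D)).
Local Notation idx := 'I_(srank P).
Local Notation act := (loc_act Q).
Local Notation x_ a := (xroot Q a).
Local Notation X_seq := (Defs.X_seq Q).
Local Notation in_DF := (Defs.in_DF P (Q := Q)).
Local Notation in_DFdual := (Defs.in_DFdual P (Q := Q)).
Implicit Types (u v w y : W) (a b : rootset D) (q : loc Q) (z : QW Q).
Implicit Types (f g h : QWdual Q) (i k : idx) (J : seq idx) (Xi : {set idx}).
Variables (I : W -> seq idx) (hI : forall w, reduced_seq w (I w)).
Variables (Xs : W -> QWdual Q) (hXs : dual_family I Xs).

Lemma longest_element : exists w0, forall a, negr P (ract w0 a) = ~~ negr P a.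
Proof.
have [w0 _ [hw0 _]] := longest_parabolic hI [set: idx]; exists w0 => a.
have aT i : i \notin [set: idx] -> coef a i = 0 by rewrite inE.
by rewrite (negr_ract_span aT hw0).
Qed.

Lemma in_DFdualB f g : in_DFdual f -> in_DFdual g -> in_DFdual (f - g).
Proof.
move=> hf hg z hz; rewrite add_lfunE opp_lfunE.
by apply: integralD; [apply: hf | apply: integralN; apply: hg].
Qed.

Lemma eta_span Xi (hXi : compatible Xi I) g :
    (forall u, u \in min_reps Xi -> in_DFdual (eta Q I Xi u)) ->
    in_DFdual_inv Xi g ->
  exists c : W -> S, g = \sum_(u in min_reps Xi) loc_in Q (c u) *: eta Q I Xi u.
Proof.
move=> hE [Lg ig]; have [w0 hw0] := longest_element.
have [v0 v0H [hv0 v0_max]] := longest_parabolic hI Xi.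
(* Beyond every length, so that the vanishing assumption holds vacuously at the start of the
   descending induction. *)
pose N := (\max_(w : W) len P w).+1.
have : forall u, u \in min_reps Xi -> (N <= len P u)%N -> dval g u = 0.
  by move=> u _; rewrite leqNgt ltnS (leq_bigmax u).
elim: N g Lg ig => [|n IH] g Lg ig g0.
  exists (fun=> 0); rewrite big1 => [|u _]; last by rewrite rmorph0 scale0r.
  apply: dvalP => w; have [u [v [hu vH ->]]] := min_reps_factor hI Xi w.
  by rewrite (dual_inv_dval ig) // g0 // dval0.
have /choice[c cE] : forall u, exists s,
    u \in min_reps Xi -> len P u = n -> dval g u = loc_in Q s * dval (eta Q I Xi u) u.
  move=> u; have [/andP[hu /eqP lu]|nu] :=
    boolP ((u \in min_reps Xi) && (len P u == n)); last first.
    by exists 0 => hu lu; rewrite hu lu eqxx in nu.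
  have [|s e] := integral_lead hI hXi hw0 v0H hv0 v0_max hu Lg ig.
    by move=> w hw; rewrite lu => lw; apply: g0.
  by exists s => _ _; rewrite (dval_eta hI hXs hXi) // eqxx mul1r.
(* [g1] has the values of [g] on the elements of [W^Xi] of length [n] and vanishes on longer
   ones. *)
pose g1 := \sum_(u | (u \in min_reps Xi) && (len P u == n)) loc_in Q (c u) *:
  eta Q I Xi u.
have Lg1 : in_DFdual g1.
  by apply: in_DFdual_comb => u /andP[hu _]; apply: hE.
have ig1 : dual_inv (parabolic Xi) g1.
  apply: dval_dual_inv => v w wH; rewrite !dval_sum; apply: eq_bigr => u _.
  have ie : dual_inv (parabolic Xi) (eta Q I Xi u) by apply: A0_inv.
  by rewrite !dvalZ (dual_inv_dval ie).
have [||w hw lw|d dE] := IH (g - g1).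
- exact: in_DFdualB.
- apply: dval_dual_inv => v w wH; rewrite !dvalB.
  by rewrite (dual_inv_dval ig) // (dual_inv_dval ig1).
- rewrite dvalB dval_sum; have [e|ne] := eqVneq (len P w) n.
    rewrite (bigD1 w) ?hw ?e ?eqxx //= big1 => [|u /andP[/andP[hu /eqP lu] nu]].
      by rewrite dvalZ -cE // addr0 subrr.
    rewrite dvalZ (dval_eta hI hXs hXi) // ?e ?lu // eq_sym (negbTE nu).
    by rewrite mul0r mulr0.
  rewrite g0 ?big1 ?subrr // => [u /andP[hu /eqP lu]|].
    rewrite dvalZ (dval_eta hI hXs hXi) ?lu //.
    have /negbTE -> : w != u by apply: contraNneq ne => ->; rewrite lu.
    by rewrite mul0r mulr0.
  by rewrite ltn_neqAle eq_sym ne.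
exists (fun u => d u + (if len P u == n then c u else 0)).
under eq_bigr => u _ do rewrite rmorphD scalerDl.
rewrite big_split /= -dE -[LHS](subrK g1); congr (_ + _).
rewrite /g1 big_mkcondr; apply: eq_bigr => u _.
by case: ifP => // _; rewrite rmorph0 scale0r.
Qed.

Lemma A0_set0 f : A0_ (finset.set0 : {set idx}) f = f.
Proof.
apply: dvalP => v; rewrite dval_A0 parabolic0 big_set1 mulg1 xprod0E.
rewrite big_pred0 ?invr1 ?rmorph1 ?mul1r // => a.
exact: neg_parabolic0.
Qed.

Lemma compatible_set0 : compatible (finset.set0 : {set idx}) I.
Proof.
move=> u v _; rewrite parabolic0 => /set1P ->; rewrite mulg1.
suff /size0nil -> : size (I 1%g) = 0%N by rewrite cats0.
by rewrite (size_reduced hI) (len1 P).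
Qed.

Lemma in_DFdual_xPi_fe : in_DFdual (xPi_fe P Q).
Proof.
have [w0 hw0] := longest_element.
have [v0 v0H [hv0 v0_max]] := longest_parabolic hI (finset.set0 : {set idx}).
suff -> : xPi_fe P Q = xind Q (finset.set0 : {set idx}).
  exact: (in_DFdual_xind hI hXs compatible_set0 hw0 v0H hv0).
apply: dvalP => w; rewrite dval_xPi_fe dval_dual_of parabolic0 mulrC.
by rewrite inE.
Qed.

(** For [Xi] empty, [eta_span] expands [g] in the [B_(I_u^rev)(x_Pi f_e)], whose pairings with [f]
    are the integral values [f(X_(I_u))]. *)
Lemma integral_pair0 f g : in_DFdual f -> in_DFdual g -> integral (pair0 P f g).
Proof.
move=> Lf Lg; have [||c ->] := @eta_span (finset.set0 : {set idx})
  compatible_set0 g.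
- move=> u _; rewrite /eta A0_set0; apply: in_DFdual_B.
  exact: in_DFdual_xPi_fe.
- split=> //; apply: dval_dual_inv => v w.
  by rewrite parabolic0 => /set1P ->; rewrite mulg1.
rewrite pair0C pair0_suml.
apply: (@integral_sum _ _ _ _ _ (mem (min_reps (finset.set0 : {set idx})))) =>
  u _.
rewrite pair0C /eta A0_set0 pair0_B_xPi_fe.
by apply: integralM; [exists (c u) | apply/Lf/in_DF_X_seq].
Qed.

Lemma fdeltaE u z : fdelta Q u z = z u.
Proof.
rewrite dual_sumE (bigD1 u) //= dval_fdelta eqxx mulr1 big1 ?addr0 // => w nw.
by rewrite dval_fdelta (negbTE nw) mulr0.
Qed.

(** Double duality: the values of the dual family at [z] are the coordinates of [z] in the
    [X_(I_w)]. *)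
Lemma in_DF_integral z : (forall w, integral (Xs w z)) -> in_DF z.
Proof.
move=> hz; have -> : z = \sum_w Xs w z *: X_seq (I w).
  apply/ffunP => u; rewrite -fdeltaE {1}(dual_expand hI hXs (fdelta Q u)).
  rewrite dual_sum sum_ffunE; apply: eq_bigr => w _.
  by rewrite dualZ fdeltaE mulrC [RHS]ffunE.
elim/big_ind: _ => [||w _].
- by have := in_DF_S P Q 0; rewrite rmorph0 scale0r.
- exact: in_DF_add.
have [s ->] := hz w.
have -> : loc_in Q s *: X_seq (I w) = qw_mul (loc_in Q s *: delta Q 1%g) (X_seq
  (I w)).
  by apply/ffunP => u; rewrite qw_mul_scal [LHS]ffunE.
by apply: in_DF_mul; [apply: in_DF_S | apply: in_DF_X_seq].
Qed.

(* [A_Xi(f)(1)] is the pairing of [f] with [x_(Pi/Xi)] times the indicator of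
   [W_Xi]; integrality of the pairing thus gives [Y_Xi] in [D_F]. *)
Lemma in_DFdual_A0 Xi f : compatible Xi I -> in_DFdual f -> in_DFdual (A0_ Xi
  f).
Proof.
move=> hXi Lf; apply: in_DFdual_act => //; apply: in_DF_integral => w.
have [w0 hw0] := longest_element.
have [v0 v0H [hv0 v0_max]] := longest_parabolic hI Xi.
have := integral_pair0 (hXs.1 w) (in_DFdual_xind hI hXs hXi hw0 v0H hv0).
suff -> : pair0 P (Xs w) (xind Q Xi) = dval (A0_ Xi (Xs w)) 1%g.
  by rewrite /dval dual_actE qw_mul1.
rewrite dval_A0 [RHS]big_mkcond; apply: eq_bigr => y _; rewrite dval_dual_of.
case: ifP => yH; last by rewrite mul0r mulr0.
rewrite !mul1g mul1r (xprod_factor _ Xi) invrM ?unit_xprod // rmorphM.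
rewrite [act y (xprod Q [set: idx] Xi)^-1]rmorphV ?unit_xprod //.
by rewrite (act_xprodT Q (parabolicT hI) yH) [_ / _ * _]mulrAC divrK
  ?unit_xprod.
Qed.

End Bases.

Theorem theorem14p7 (R : comNzRingType) (F : fgl R)
    (D : root_datum) (P : simple_system D) (Q : localized_fga F D)
    (hreg : forall (a : rootset D) (s : fga F (lat D)),
      fga_var F (val a) * s = 0 -> s = 0)
    (I : weyl D -> seq 'I_(srank P))
    (hI : forall w, reduced_seq w (I w))
    (Xs : weyl D -> QWdual Q) (hXs : dual_family I Xs)
    (Xi : {set 'I_(srank P)}) (hXi : compatible Xi I)
    (X : {set weyl D}) (hX : coset_reps [set: 'I_(srank P)] Xi X) :
  let M : QWdual Q -> Prop := in_DFdual_inv Xi in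
  let eta (w : weyl D) : QWdual Q :=
    A0_ Xi (B_seq (rev (I w)) (xPi_fe P Q)) in
  let pair (f g : QWdual Q) : QWdual Q :=
    A_ [set: 'I_(srank P)] Xi X (dual_mul f g) in
  (forall u w, u \in min_reps Xi ->
     pair (Xs u) (eta w) = (w == u)%:R *: dual_one Q) /\
  (forall f g, M f -> M g ->
     [/\ in_DFdual P (pair f g), dual_inv [set: weyl D] (pair f g) &
         exists s, pair f g = loc_in Q s *: dual_one Q]) /\
  nondegenerate_pairing M pair /\
  S_basis M (min_reps Xi) eta /\
  S_basis M (min_reps Xi) Xs /\
  (forall u v, u \in min_reps Xi -> v \in min_reps Xi ->
     pair (eta u) (Xs v) = (u == v)%:R *: dual_one Q).
Proof.
move=> M eta' pair.
have LXs w : in_DFdual P (Xs w) := hXs.1 w.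
have Meta w : M (eta' w).
  split; last exact: A0_inv.
  apply: (in_DFdual_A0 hI hXs) => //; apply: in_DFdual_B.
  exact: (in_DFdual_xPi_fe hI hXs).
have MXs u : u \in min_reps Xi -> M (Xs u).
  by move=> hu; split=> //; apply: (dual_min_inv hI hXs).
have pairC f g : pair f g = pair g f.
  by rewrite /pair /dual_mul; under eq_bigr => w _ do rewrite mulrC.
have one0 q : q *: dual_one Q = 0 -> q = 0.
  by move=> /(congr1 (fun f => dval f 1%g)); rewrite dvalZ dval_one dval0 mulr1.
have pairE f w : M f -> pair f (eta' w) = f (X_seq Q (I w)) *: dual_one Q.
  by case=> _ hf; apply: (pair_eta hI).
have pairX u w : u \in min_reps Xi ->
    pair (Xs u) (eta' w) = (w == u)%:R *: dual_one Q.
  by move=> hu; rewrite pairE ?hXs.2 1?eq_sym //; apply: MXs.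
have span g : M g -> exists c : weyl D -> fga F (lat D),
    g = \sum_(u in min_reps Xi) loc_in Q (c u) *: eta' u.
  by apply: (eta_span hI hXs) => // u _; case: (Meta u).
have pair_sum f (A : pred (weyl D)) c : M f ->
    pair f (\sum_(u | A u) loc_in Q (c u) *: eta' u) =
    (\sum_(u | A u) loc_in Q (c u) * f (X_seq Q (I u))) *: dual_one Q.
  move=> Mf; rewrite /pair A_mul_sumr scaler_suml; apply: eq_bigr => u _.
  by rewrite -/(pair _ _) pairE // scalerA.
(* Pairing with the [eta' u] reads off the coordinates of [f] in the [Xs u]. *)
have zero f : M f -> (forall g, M g -> pair f g = 0) -> f = 0.
  move=> Mf h; rewrite (inv_expand hI hXs hXi Mf.2) big1 // => u _.
  by rewrite (one0 (f _)) ?scale0r // -pairE // h.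
split; first exact: pairX.
split.
  move=> f g Mf /span[c ->]; rewrite pair_sum //.
  have [s ->] : integral (\sum_(u in min_reps Xi) loc_in Q (c u) * f (X_seq Q
    (I u))).
    apply: integral_sum => u _; apply: integralM; first by exists (c u).
    by apply: Mf.1; apply: in_DF_X_seq.
  split; last by exists s.
    move=> z hz; rewrite dualZ; apply: integralM; first by exists s.
    by apply: (in_DFdual_one hI hXs).
  by move=> w _; apply: dvalP => v; rewrite dval_act_delta !dvalZ !dval_one.
split.
  split=> // g Mg h; apply: zero => // f Mf.
  by rewrite pairC h.
split.
  (* Independence of the [eta' u]: pairing a relation with [Xs w] isolates [c w], and regularity
     brings the equation from [Q] back to [S]. *)
  split=> [w _ //|//|c e w hw].
  apply: (loc_in_inj hreg); rewrite rmorph0; apply: one0.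
  have := pair_sum (Xs w) (mem (min_reps Xi)) c (MXs w hw).
  rewrite [\sum_(u in _) _ *: _]e => h.
  have -> : loc_in Q (c w) =
      \sum_(u in min_reps Xi) loc_in Q (c u) * Xs w (X_seq Q (I u)).
    rewrite (bigD1 w) //= hXs.2 eqxx mulr1 big1 ?addr0 // => u /andP[_ nu].
    by rewrite hXs.2 eq_sym (negbTE nu) mulr0.
  rewrite -h pairC /pair /dual_mul big1 => [|v _].
    by apply: dvalP => v; rewrite dval_A dval0 big1 // => y _; rewrite dval0 mulr0.
  by rewrite zero_lfunE mul0r scale0r.
split; last first.
  by move=> u v hu hv; rewrite pairC pairX.
(* For the [Xs u], coordinates are the values at the [X_(I_u)], integral by membership in [M]. *)
split=> [//|f Mf|c e w hw].
  have /choice[c cE] : forall u, exists s, f (X_seq Q (I u)) = loc_in Q s.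
    by move=> u; apply: Mf.1; apply: in_DF_X_seq.
  exists c; rewrite {1}(inv_expand hI hXs hXi Mf.2).
  by apply: eq_bigr => u _; rewrite cE.
apply: (loc_in_inj hreg); rewrite rmorph0.
have := congr1 (fun g : QWdual Q => g (X_seq Q (I w)) : loc Q) e.
rewrite /= zero_lfunE => h; apply: etrans h.
rewrite dual_sum (bigD1 w) //= dualZ hXs.2 eqxx mulr1 big1 ?addr0 //.
by move=> u /andP[_ nu]; rewrite dualZ hXs.2 (negbTE nu) mulr0.
Qed.
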